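(* Let $x\in\mathbb{R}$. Given $\gamma>0$, let $\eta$ be an exponential random variable with mean $\frac{2}{\gamma^2}$ independent of $W$. Then, as $T\to\infty$, the probability measures $$\mathbb{P}_x\left((W_t)_{t\ge 0}\in\cdot\;\middle|\; I_T\le \eta\right)$$ converge weakly on $\mathcal{C}([0,\infty))$ to the law of an Ornstein--Uhlenbeck process $(X_t)_{t\ge 0}$ satisfying $$X_0=x,\qquad \mathrm{d}X_t=\mathrm{d}B_t-\gamma X_t\,\mathrm{d}t,\quad t\ge 0,$$ where $(B_t)_{t\ge 0}$ is a standard Brownian motion.
   Context: Under $\mathbb{P}_x$, the process $W=(W_t)_{t\ge 0}$ is a one-dimensional Brownian motion starting at $x\in\mathbb{R}$, and $I_T:=\int_0^T W_s^2\,\mathrm{d}s$ for $T\ge 0$. $\mathcal{C}([0,\infty))$ is the space of continuous real-valued functions on $[0,\infty)$ with the topology of uniform convergence on compact sets. *)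

(* Defs.v *)
From HB Require Import structures.
From mathcomp Require Import all_boot all_order all_algebra.
From mathcomp Require Import all_classical all_reals all_analysis.
From mathcomp Require Import ring lra.
Import Order.TTheory GRing.Theory Num.Theory.
Import numFieldNormedType.Exports.

Set Implicit Arguments.
Unset Strict Implicit.
Unset Printing Implicit Defensive.

Local Open Scope classical_set_scope.
Local Open Scope ring_scope.

Definition halfline (R : realType) : Type := set_type `[(0 : R), +oo[.
HB.instance Definition _ (R : realType) := Uniform.on (halfline R).

Definition pathspace (R : realType) : Type := continuousType (halfline R) R.

HB.instance Definition _ (R : realType) := Choice.on (pathspace R).
HB.instance Definition _ (R : realType) :=
  isPointed.Build (pathspace R) (cst 0 : continuousType (halfline R) R).
(* [{family compact, _ -> _}] carries the topology of uniform convergence on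
   compact sets; [pathspace R] inherits it as a set of functions. *)
HB.instance Definition _ (R : realType) :=
  Uniform.copy (pathspace R)
    (initial_topology
       (id : continuousType (halfline R) R ->
             {family compact, halfline R -> R})).

(* Borel sigma-algebra of that topology *)
HB.instance Definition _ (R : realType) :=
  Measurable.copy (pathspace R) (g_sigma_algebraType (@open (pathspace R))).

Lemma clip_subproof (R : realType) (t : R) :
  Num.max 0 t \in `[(0 : R), +oo[%classic.
Proof. by rewrite inE/= in_itv/= andbT le_max lexx. Qed.

Definition clip (R : realType) (t : R) : halfline R :=
  exist (fun u : R => u \in `[(0 : R), +oo[%classic) _ (clip_subproof t).

(* The value w_t of a path, for t >= 0. Paths are frozen at w_0 at negative
   times, which are never used. *)
Definition eval_at (R : realType) (w : pathspace R) (t : R) : R := w (clip t).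

Definition sq_integral (R : realType) (T : R) (w : pathspace R) : R :=
  (\int[lebesgue_measure]_(s in `[0%R, T]) (eval_at w s ^+ 2))%R.

Lemma continuous_clip (R : realType) : continuous (@clip R).
Proof.
apply: continuous_comp_initial => t.
have -> : set_val \o @clip R = (fun t => Num.max 0 t).
  by apply/funext => u; rewrite /= set_valE.
by apply: continuous_max; [exact: cvg_cst|exact: cvg_id].
Qed.

Lemma continuous_eval_at (R : realType) (w : pathspace R) :
  continuous (eval_at w).
Proof.
by move=> t; apply: continuous_comp; [exact: continuous_clip|exact: cts_fun].
Qed.

Lemma integrable_sq_path (R : realType) (w : pathspace R) (T : R) :
  (@lebesgue_measure R).-integrable `[0, T]
    (EFin \o (fun s => (eval_at w s ^+ 2 : R))).
Proof.
apply: continuous_compact_integrable; first exact: segment_compact.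
apply: continuous_subspaceT => t.
by apply: continuousM; exact: continuous_eval_at.
Qed.

Lemma continuous_sq_integral (R : realType) (T : R) :
  continuous (@sq_integral R T).
Proof.
move=> w; apply/(@cvgrPdist_le _ _ _ (nbhs w) (nbhs_filter w)) => e e0.
pose mu := @lebesgue_measure R.
pose I := `[(0 : R), T]%classic.
pose K := @clip R @` I.
have cK : compact K.
  apply: continuous_compact; last exact: segment_compact.
  exact/continuous_subspaceT/continuous_clip.
have [M M0 wM] : exists2 M : R, 0 <= M & forall s, I s -> `|eval_at w s| <= M.
  have /compact_bounded[N [_ Nb]] : compact ((eval_at w) @` I : set R^o).
    apply: continuous_compact; last exact: segment_compact.
    exact/continuous_subspaceT/continuous_eval_at.
  exists (`|N| + 1) => [|s Is]; first by rewrite addr_ge0.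
  apply: Nb; last by exists s.
  by rewrite (le_lt_trans (ler_norm _))// ltrDl.
pose L := fine (mu I).
have L0 : 0 <= L by exact: fine_ge0.
have L1 : 0 < (L + 1) * (2 * M + 1).
  by rewrite mulr_gt0// ltr_wpDl// mulr_ge0.
pose d := Num.min 1 (e / ((L + 1) * (2 * M + 1))).
have d0 : 0 < d by rewrite lt_min ltr01 divr_gt0.
have nd : \forall v \near w, forall s, I s -> `|eval_at w s - eval_at v s| < d.
  have wK : nbhs (w : {family compact, halfline R -> R})
      [set h : halfline R -> R | forall y, K y -> `|w y - h y| < d].
    have /fam_cvgP/(_ K cK) : {family compact,
      nbhs (w : {family compact, halfline R -> R}) --> (w : halfline R -> R)}.
      exact: cvg_id.
    apply; apply/uniform_nbhs; exists [set xy | ball xy.1 d xy.2].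
    by split => //; exact: (entourage_ball R^o (PosNum d0)).
  have : nbhs (w : pathspace R)
      [set v : pathspace R | forall y, K y -> `|w y - v y| < d].
    exact: (@initial_continuous (continuousType (halfline R) R)
      {family compact, halfline R -> R} id w _ wK).
  by apply: filterS => v vK s Is; apply: vK; exists s.
near=> v.
have vd : forall s, I s -> `|eval_at w s - eval_at v s| < d by near: v.
rewrite /sq_integral -RintegralB//=; [|exact: integrable_sq_path..].
have mI : @measurable _ (measurableTypeR R) I by exact: measurable_itv.
have iB : mu.-integrable I
    (EFin \o (fun s => eval_at w s ^+ 2 - eval_at v s ^+ 2)).
  apply: continuous_compact_integrable; first exact: segment_compact.
  apply: continuous_subspaceT => t.
  have sq (u : pathspace R) : {for t, continuous (fun s => eval_at u s ^+ 2)}.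
    by apply: continuousM; exact: continuous_eval_at.
  by apply: cvgB; exact: sq.
apply: (le_trans (le_normr_Rintegral mI iB)).
have cI : mu.-integrable I (EFin \o cst (d * (2 * M + 1))).
  apply: continuous_compact_integrable; first exact: segment_compact.
  by apply: continuous_subspaceT => t; exact: cvg_cst.
apply: (@le_trans _ _ (\int[mu]_(s in I) (d * (2 * M + 1)))%R).
  apply: le_Rintegral => //; first exact: (integrable_norm iB).
  move=> s Is.
  rewrite subr_sqr normrM ler_pM//; first exact/ltW/vd.
  have -> : eval_at w s + eval_at v s =
      2 * eval_at w s - (eval_at w s - eval_at v s).
    by rewrite opprB addrCA mulr_natl mulr2n; ring.
  rewrite (le_trans (ler_normB _ _))// lerD//.
    by rewrite normrM ger0_norm// ler_pM2l// wM.
  by rewrite (le_trans (ltW (vd s Is)))// ge_min lexx.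
rewrite Rintegral_cst// -/L.
have : d <= e / ((L + 1) * (2 * M + 1)) by rewrite ge_min lexx orbT.
rewrite ler_pdivlMr// => /(le_trans _); apply.
rewrite -mulrA ler_pM2l// mulrC ler_wpM2r ?lerDl//.
by rewrite addr_ge0// mulr_ge0.
Unshelve. all: by end_near. Qed.

Lemma continuous_pathspace_measurable (R : realType) (f : pathspace R -> R) :
  continuous f -> measurable_fun setT f.
Proof.
move=> /continuousP cf; apply: (measurability _ (measurable_realfun.RGenOpens.measurableE R)).
move=> _ [_ [a [b ->] <-]]; rewrite setTI; apply: sub_sigma_algebra.
exact/cf/interval_open.
Qed.

Lemma measurable_sq_integral_le d (Omega : measurableType d) (R : realType)
    (P : probability Omega R) (W : {RV P >-> pathspace R}) (eta : {RV P >-> R})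
    (T : R) :
  measurable [set omega | sq_integral T (W omega) <= eta omega].
Proof.
rewrite -[X in measurable X]setTI; apply: measurable_fun_le => //.
apply: measurableT_comp; last exact: measurable_funPT.
exact: (continuous_pathspace_measurable (@continuous_sq_integral R T)).
Qed.

Definition independent_pair d (Omega : measurableType d) (R : realType)
    (P : probability Omega R) d1 (T1 : measurableType d1)
    d2 (T2 : measurableType d2) (X : Omega -> T1) (Y : Omega -> T2) : Prop :=
  forall (A : set T1) (B : set T2), measurable A -> measurable B ->
    P (X @^-1` A `&` Y @^-1` B) = (P (X @^-1` A) * P (Y @^-1` B))%E.

(* Taking some [A i] to be [setT] gives the product rule for subfamilies. *)
Definition mutually_independent d (Omega : measurableType d) (R : realType)
    (P : probability Omega R) d' (T : measurableType d') (n : nat)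
    (X : 'I_n -> Omega -> T) : Prop :=
  forall A : 'I_n -> set T, (forall i, measurable (A i)) ->
    P (\bigcap_i (X i @^-1` A i)) = (\prod_(i < n) P (X i @^-1` A i))%E.

Definition brownian_motion d (Omega : measurableType d) (R : realType)
    (P : probability Omega R) (x : R) (W : {RV P >-> pathspace R}) : Prop :=
  [/\ {ae P, forall omega, eval_at (W omega) 0 = x},
      (forall (s t : R) (A : set R), 0 <= s -> s < t -> measurable A ->
        P ((fun omega => eval_at (W omega) t - eval_at (W omega) s) @^-1` A) =
        normal_prob 0 (Num.sqrt (t - s)) A)
    & (forall (n : nat) (t : nat -> R), 0 <= t 0%N ->
        {homo t : i j / (i <= j)%N >-> i <= j} ->
        mutually_independent P (fun (i : 'I_n) omega =>
          eval_at (W omega) (t i.+1) - eval_at (W omega) (t i)))].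

Definition exponential_RV d (Omega : measurableType d) (R : realType)
    (P : probability Omega R) (mean : R) (eta : {RV P >-> R}) : Prop :=
  forall A : set R, measurable A ->
    distribution P eta A = exponential_prob mean^-1 A.

(* The noise is additive, so dX_t = dB_t - gamma X_t dt is the pathwise
   integral equation below. *)
Definition ornstein_uhlenbeck d (Omega : measurableType d) (R : realType)
    (P : probability Omega R) (gamma x : R) (X : {RV P >-> pathspace R}) :
    Prop :=
  exists B : {RV P >-> pathspace R},
    brownian_motion 0 B /\
    {ae P, forall omega, eval_at (X omega) 0 = x /\
      forall t : R, 0 <= t ->
        eval_at (X omega) t = eval_at (X omega) 0 + eval_at (B omega) t -
          gamma * (\int[lebesgue_measure]_(s in `[0%R, t])
                     eval_at (X omega) s)%R}.

(* P(. | E); the last argument of [mnormalize] is its value when P E = 0. *)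
Definition conditional_prob d (Omega : measurableType d) (R : realType)
    (P : probability Omega R) (E : set Omega) (mE : measurable E) :
    probability Omega R :=
  mnormalize (mrestr P mE) P.

Definition penalized_law d (Omega : measurableType d) (R : realType)
    (P : probability Omega R) (W : {RV P >-> pathspace R}) (eta : {RV P >-> R})
    (T : R) : probability (pathspace R) R :=
  distribution (conditional_prob P (measurable_sq_integral_le W eta T)) W.

Definition weak_cvg (R : realType) (I : Type) (F : set_system I)
    (mu : I -> probability (pathspace R) R)
    (nu : probability (pathspace R) R) : Prop :=
  forall f : pathspace R -> R, continuous f -> bounded_fun f ->
    (\int[mu i]_w f w)%R @[i --> F] --> (\int[nu]_w f w)%R.

(* Main.v *)
Require Import Defs.
From HB Require Import structures.
From mathcomp Require Import all_boot all_order all_algebra.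
From mathcomp Require Import all_classical all_reals all_analysis.
From mathcomp Require Import measurable_realfun.
From mathcomp Require Import ring lra.
Import Order.TTheory GRing.Theory Num.Theory.
Import numFieldNormedType.Exports.

(** Since [eta] is exponential of rate [gamma^2 / 2] and independent of [W],
    conditioning on [I_T <= eta] amounts to reweighting the law of [W] by
    [exp (- gamma^2 I_T / 2)] ([ge0_integral_penalized_law]). In continuous
    time, Girsanov's theorem turns the reweighted Brownian motion into the
    diffusion with drift [- gamma tanh (gamma (T - t)) x], which approaches
    [- gamma x] as [T] grows. The proof replaces that theorem by an exact
    finite-dimensional identity on a grid, and then refines the grid.

    On the grid of mesh [h = T / N], replace [I_T] by the left Riemann sum of
    the squares. Multiplying a Gaussian transition density by
    [exp (- s y^2 / 2)] gives again a Gaussian density, with mean [r w] and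
    variance [h r] for [r = 1 / (1 + h s)], up to a factor that is itself of
    the form [exp (- s r w^2 / 2)] ([normal_pdf_tilt]). Integrating out the
    increments one at a time, from the last to the first, thus identifies the
    reweighted random walk with an autoregressive chain
    [Y (k+1) = r k * Y k + noise], the noise having variance [h * r k]
    ([tilted_expectation]). With the coefficients [s] given by a backward
    Riccati recursion, the weight is the exponential of the Riemann sum
    ([discrete_girsanov]).

    The noise may be realised as the increments of any Brownian motion along a
    clock with steps [h * r k], and the one taken is the Brownian motion [B]
    that drives the Ornstein-Uhlenbeck process [X] of the statement. This
    coupling turns convergence in law into convergence of paths.
    - For fixed [T] and [N] tending to infinity, interpolated walks converge to
      [W] and Riemann sums to [I_T], so expectations of functionals of the
      interpolated chain converge to their expectations under the conditioned
      law ([ou_chain_cvg_penalized]).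
    - For [T] tending to infinity, take for each [T] a mesh so fine that this
      limit is almost attained. Away from the horizon the Riccati coefficients
      are nearly stationary, hence [r k = 1 - gamma h + o(h)] and the chain is
      an Euler scheme for [dX = dB - gamma X dt]; it converges to [X] locally
      uniformly along almost every path ([ou_scheme_cvg]).
    Both limits are transferred to expectations of bounded continuous
    functionals by bounded convergence. A functional of an interpolated path
    depends on finitely many values, so its expectation is determined by the
    finite-dimensional distributions of [W] and [B]. *)

Set Implicit Arguments.
Unset Strict Implicit.
Unset Printing Implicit Defensive.

Local Open Scope classical_set_scope.
Local Open Scope ring_scope.


(** * Densities and Gaussian integrals *)

Section density.
Local Open Scope ereal_scope.
Context d (T : measurableType d) (R : realType).
Variables (mu nu : {measure set T -> \bar R}) (p : T -> R).
Hypothesis mp : measurable_fun [set: T] p.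
Hypothesis p0 : forall x, (0 <= p x)%R.
Let mEp : measurable_fun [set: T] (EFin \o p).
Proof. exact/measurable_EFinP. Qed.

Hypothesis nuE : forall A, measurable A -> nu A = \int[mu]_(x in A) (p x)%:E.

Import HBNNSimple.

(** Both sides agree on indicators by [nuE], hence on nonnegative simple
    functions, and monotone convergence does the rest. *)
Lemma ge0_integral_density (f : T -> \bar R) :
  measurable_fun [set: T] f -> (forall x, 0 <= f x) ->
  \int[nu]_x f x = \int[mu]_x (f x * (p x)%:E).
Proof.
move=> mf f0.
pose f_ := nnsfun_approx measurableT mf.
have step n : \int[nu]_x (f_ n x)%:E = \int[mu]_x ((f_ n x)%:E * (p x)%:E).
  under eq_integral do rewrite fimfunE -fsumEFin//.
  rewrite ge0_integral_fsum//; last 2 first.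
  - by move=> y; exact/measurable_EFinP/measurable_funM.
  - by move=> y x _; rewrite nnfun_muleindic_ge0.
  transitivity (\int[mu]_x \sum_(k \in range (f_ n))
      (k * \1_(f_ n @^-1` [set k]) x)%:E * (p x)%:E); last first.
    apply: eq_integral => x _; rewrite fimfunE -fsumEFin//.
    rewrite ge0_mule_fsuml// => k.
    by rewrite nnfun_muleindic_ge0.
  rewrite ge0_integral_fsum//; last 2 first.
  - move=> k; apply: emeasurable_funM => //.
    by apply/measurable_EFinP/measurable_funM.
  - move=> k x _; rewrite mule_ge0 ?lee_fin// -lee_fin EFinM.
    by rewrite nnfun_muleindic_ge0.
  apply: eq_fsbigr => k /[!inE] -[x _ fxk].
  have k0 : (0 <= k)%R by rewrite -fxk.
  rewrite integralZl_indic_nnsfun// integral_indic// setIT nuE//.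
  under [RHS]eq_integral do rewrite EFinM -muleA.
  rewrite ge0_integralZl//; last 2 first.
  - apply: emeasurable_funM => //.
    exact/measurable_EFinP.
  - by move=> y _; rewrite mule_ge0// lee_fin.
  congr (_ * _); rewrite integral_mkcond; apply: eq_integral => y _.
  by rewrite patchE indicE; case: (_ \in _); rewrite ?mul1e ?mul0e.
transitivity (limn (fun n => \int[nu]_x (f_ n x)%:E)).
  rewrite -monotone_convergence//.
  - apply: eq_integral => y _; apply/esym/cvg_lim => //.
    exact: cvg_nnsfun_approx.
  - by move=> n; exact/measurable_EFinP.
  - by move=> n y _; rewrite lee_fin.
  - by move=> y _ m n mn; rewrite lee_fin; exact/lefP/nd_nnsfun_approx.
under eq_fun do rewrite step.
rewrite -monotone_convergence//.
- apply: eq_integral => y _; apply/cvg_lim => //.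
  by apply: cvgeZr => //; exact: cvg_nnsfun_approx.
- by move=> n; apply: emeasurable_funM => //; exact/measurable_EFinP.
- by move=> n y _; rewrite mule_ge0// lee_fin.
- move=> y _ m n mn; rewrite lee_wpmul2r ?lee_fin//.
  exact/lefP/nd_nnsfun_approx.
Qed.

End density.

Section normal_shift.
Context (R : realType).
Notation mu := (@lebesgue_measure R).

Lemma lebesgue_measure_shift (c : R) (A : set R) : measurable A ->
  pushforward mu (fun y : R => c + y : measurableTypeR R) A = mu A.
Proof.
have mc : measurable_fun [set: measurableTypeR R]
    (fun y : R => c + y : measurableTypeR R) by exact: measurable_funD.
move=> mA; apply/esym/lebesgue_measure_unique => //= _ [[a b]] _ <-.
rewrite /pushforward/=.
have -> : (fun y => c + y) @^-1` `]a, b] = `]a - c, b - c]%classic.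
  by apply/seteqP; split => y/=; rewrite !in_itv/= ltrBlDl lerBrDl.
rewrite !lebesgue_measure_itv/= !lte_fin ltrD2r.
by case: ifP => // _; rewrite -!EFinB; congr EFin; ring.
Qed.

Lemma ge0_integral_shift (c : R) (f : R -> \bar R) :
  measurable_fun [set: R] f -> (forall y, (0 <= f y)%E) ->
  (\int[mu]_y f (c + y)%R = \int[mu]_y f y)%E.
Proof.
move=> mf f0.
have mc : measurable_fun [set: measurableTypeR R]
    (fun y : R => c + y : measurableTypeR R) by exact: measurable_funD.
transitivity (\int[pushforward mu
    (fun y : R => (c + y)%R : measurableTypeR R)]_y f y)%E.
  by rewrite ge0_integral_pushforward.
by apply: eq_measure_integral => A mA _; exact: lebesgue_measure_shift.
Qed.

Lemma ge0_integral_normal_prob (s : R) (f : R -> \bar R) :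
  measurable_fun [set: R] f -> (forall y, (0 <= f y)%E) ->
  (\int[normal_prob 0 s]_y f y = \int[mu]_y (f y * (normal_pdf 0 s y)%:E))%E.
Proof.
move=> mf f0; apply: ge0_integral_density => //.
- exact: measurable_normal_pdf.
- by move=> y; exact: normal_pdf_ge0.
Qed.

Lemma normal_pdf_center (m s y : R) : s != 0 ->
  normal_pdf m s (m + y) = normal_pdf 0 s y.
Proof.
by move=> s0; rewrite !normal_pdfE// normal_fun_center/= addrC addKr.
Qed.

(** Writes the law of [c + Z], for a centred Gaussian [Z], through the density
    of mean [c]: an increment added to the current value of a chain becomes a
    transition density from that value. *)
Lemma ge0_integral_normal_prob_shift (c s : R) (f : R -> \bar R) : s != 0 ->
  measurable_fun [set: R] f -> (forall y, (0 <= f y)%E) ->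
  (\int[normal_prob 0 s]_y f (c + y)%R =
   \int[mu]_y (f y * (normal_pdf c s y)%:E))%E.
Proof.
move=> s0 mf f0.
have mfc : measurable_fun [set: R] (fun y => f (c + y)%R).
  by apply: measurableT_comp => //; exact: measurable_funD.
have mpdf : measurable_fun [set: R] (fun y => (normal_pdf c s y)%:E).
  by apply/measurable_EFinP; exact: measurable_normal_pdf.
rewrite (ge0_integral_normal_prob s mfc (fun y => f0 (c + y)%R)).
have mfp : measurable_fun [set: R] (fun y => (f y * (normal_pdf c s y)%:E)%E).
  exact: emeasurable_funM.
rewrite -(ge0_integral_shift c mfp); last first.
  by move=> y; rewrite mule_ge0// lee_fin normal_pdf_ge0.
by apply: eq_integral => y _; rewrite normal_pdf_center.
Qed.

End normal_shift.

(** * Independence of an increment from the past *)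

Section independence.
Context d (Omega : measurableType d) (R : realType) (P : probability Omega R).

Section past.
Variable (Z : nat -> Omega -> R).
Hypothesis mZ : forall i, measurable_fun [set: Omega] (Z i).
Hypothesis iZ : forall n, mutually_independent P (fun i : 'I_n => Z i).

Definition past n (omega : Omega) : n.-tuple R := [tuple Z i omega | i < n].

Lemma measurable_past n : measurable_fun [set: Omega] (past n).
Proof.
apply/measurable_fun_tnthP => i.
by rewrite (_ : _ \o _ = Z i)//; apply/funext => w/=; rewrite tnth_mktuple.
Qed.

(** Boxes are stable under intersection, so they can serve as the pi-system on
    which two laws of tuples are compared. *)
Lemma measurable_tuple_boxes n :
  @measurable _ (n.-tuple R) = <<s [set S | exists2 A : 'I_n -> set R,
    forall i, measurable (A i) &
    S = \bigcap_i ((fun t : n.-tuple R => tnth t i) @^-1` A i)] >>.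
Proof.
apply/seteqP; split; last first.
  apply: smallest_sub; first exact: sigma_algebra_measurable.
  move=> _ [A mA ->]; apply: fin_bigcap_measurable => // i _.
  by rewrite -[X in measurable X]setTI; exact: measurable_tnth.
apply: smallest_sub; first exact: smallest_sigma_algebra.
rewrite -bigcup_seq => S [i _ [B mB <-]]; apply: sub_sigma_algebra.
exists (fun j => if j == i then B else setT).
  by move=> j; case: ifP.
rewrite setTI; apply/seteqP; split => t /=.
  by move=> Bt j _ /=; case: eqP => // ->.
by move=> /(_ i Logic.I)/=; rewrite eqxx.
Qed.

(** Mutual independence only gives the product rule on boxes; for a fixed event
    on [Z n], both sides are finite measures in the event on the past, and two
    finite measures that agree on boxes are equal. *)
Lemma independent_past n : independent_pair P (past n) (Z n).
Proof.
move=> S B mS mB.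
have mZB : measurable (Z n @^-1` B).
  by rewrite -[X in measurable X]setTI; exact: mZ.
have mpast := @measurable_past n.
have pB : P (Z n @^-1` B) \is a fin_num by exact: fin_num_measure.
pose c : {nonneg R} := NngNum (fine_ge0 (measure_ge0 P (Z n @^-1` B))).
pose m1 : {measure set (n.-tuple R) -> \bar R} :=
  pushforward (mrestr P mZB) (past n).
pose m2 : {measure set (n.-tuple R) -> \bar R} :=
  mscale c (pushforward P (past n)).
have -> : P (past n @^-1` S `&` Z n @^-1` B) = m1 mpast S by [].
have -> : (P (past n @^-1` S) * P (Z n @^-1` B))%E = m2 mpast S.
  by rewrite /m2/= /mscale/= /c/= fineK// muleC.
apply: (measure_unique _ (fun=> setT) (measurable_tuple_boxes n)) => //.
- move=> _ _ [A mA ->] [A' mA' ->]; exists (fun i => A i `&` A' i).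
    by move=> i; exact: measurableI.
  rewrite -bigcapI; apply: eq_bigcapr => i _.
  by rewrite preimage_setI.
- move=> _; exists (fun=> setT) => //.
  by apply/seteqP; split => // t _ i _.
- by apply/seteqP; split => // t _; exists 0%N.
- move=> _ [A mA ->].
  rewrite /m1 /m2/= /mscale/= /pushforward /mrestr/= fineK//.
  have boxE : past n @^-1`
      (\bigcap_i ((fun t : n.-tuple R => tnth t i) @^-1` A i)) =
      \bigcap_i (Z (nat_of_ord i) @^-1` A i).
    apply/seteqP; split => w /= Aw i _; move: (Aw i Logic.I) => /=;
      by rewrite tnth_mktuple.
  rewrite boxE.
  pose A' (i : 'I_n.+1) := if unlift ord_max i is Some j then A j else B.
  have := iZ (A := A') (n := n.+1).
  have -> : \bigcap_i ((fun i : 'I_n.+1 => Z i) i @^-1` A' i) =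
      \bigcap_(i in [set: 'I_n]) (Z (nat_of_ord i) @^-1` A i) `&` Z n @^-1` B.
    apply/seteqP; split => [w Aw|w [Aw Bw] i _].
      split => [i _|].
        have := Aw (lift ord_max i) Logic.I.
        by rewrite /A' liftK /preimage /mkset; cbv beta; rewrite lift_max.
      by have := Aw ord_max Logic.I; rewrite /A'/= unlift_none.
    rewrite /A'; case: unliftP => [j ->|->//].
    by rewrite /preimage /mkset; cbv beta; rewrite lift_max; exact: Aw.
  move=> ->; last by rewrite /A' => i; case: unlift.
  rewrite big_ord_recr/= iZ// /A' unlift_none muleC; congr (_ * _)%E.
  apply: eq_bigr => i _.
  have -> : widen_ord (leqnSn n) i = lift ord_max i.
    by apply: val_inj; rewrite /= /bump leqNgt ltn_ord.
  by rewrite liftK.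
- move=> _; rewrite /m1/= /pushforward /mrestr preimage_setT setTI.
  by rewrite (le_lt_trans (probability_le1 _ mZB))// ltry.
Qed.

End past.

(** Independence says that the joint law of [X] and [Y] is the product of the
    laws; the formula is then Tonelli's theorem. *)
Lemma ge0_expectation_indep d1 (T1 : measurableType d1)
    d2 (T2 : measurableType d2) (X : Omega -> T1) (Y : Omega -> T2)
    (nu : probability T2 R) (g : T1 * T2 -> \bar R) :
  measurable_fun [set: Omega] X -> measurable_fun [set: Omega] Y ->
  independent_pair P X Y ->
  (forall B, measurable B -> P (Y @^-1` B) = nu B) ->
  measurable_fun [set: T1 * T2] g -> (forall z, (0 <= g z)%E) ->
  (\int[P]_w g (X w, Y w) = \int[P]_w \int[nu]_y g (X w, y))%E.
Proof.
move=> mX mY iXY Ynu mg g0.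
have mXY : measurable_fun [set: Omega] (fun w => (X w, Y w)).
  exact: measurable_fun_pair.
pose Xm : {mfun Omega >-> T1} := HB.pack X (isMeasurableFun.Build _ _ _ _ X mX).
pose PX : probability T1 R := distribution P Xm.
transitivity (\int[pushforward P (fun w => (X w, Y w))]_z g z)%E.
  by rewrite ge0_integral_pushforward.
transitivity (\int[(PX \x nu)%E]_z g z)%E.
  apply: eq_measure_integral => S mS _.
  apply/esym/product_measure_unique => // A B mA mB.
  rewrite /= -Ynu// -iXY//.
rewrite fubini_tonelli1// ge0_integral_distribution//.
- exact: measurable_fun_fubini_tonelli_F.
- by move=> x; exact: integral_ge0.
Qed.

End independence.

(** * Autoregressive chains *)

Section ar_chain.
Context (R : realType).
Implicit Types (r z : nat -> R) (x : R).

Fixpoint ar_chain r x z (n : nat) : R :=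
  if n is m.+1 then r m * ar_chain r x z m + z m else x.

(** The latest value comes first: extending the chain is then a [cons], and the
    current value is the head. *)
Fixpoint ar_path r x z (n : nat) : n.+1.-tuple R :=
  if n is m.+1 then [tuple of ar_chain r x z m.+1 :: ar_path r x z m]
  else [tuple x].

Lemma nth_ar_path r x z n k : (k <= n)%N ->
  nth 0 (ar_path r x z n) (n - k) = ar_chain r x z k.
Proof.
elim: n => [|n IH]; first by rewrite leqn0 => /eqP ->.
rewrite leq_eqVlt => /predU1P[->|]; first by rewrite subnn.
by rewrite ltnS => kn; rewrite subSn//= IH.
Qed.

Lemma nth0_ar_path r x z n : nth 0 (ar_path r x z n) 0 = ar_chain r x z n.
Proof. by case: n. Qed.

Lemma eq_ar_chain r x z z' n : (forall k, (k < n)%N -> z k = z' k) ->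
  ar_chain r x z n = ar_chain r x z' n.
Proof.
elim: n => //= n IH zz'; rewrite zz'// IH// => k kn.
by apply: zz'; rewrite ltnW.
Qed.

Lemma eq_ar_path r x z z' n : (forall k, (k < n)%N -> z k = z' k) ->
  ar_path r x z n = ar_path r x z' n.
Proof.
elim: n => //= n IH zz'; rewrite IH; last by move=> k kn; rewrite zz'// ltnW.
rewrite zz'// (@eq_ar_chain _ _ z z')// => k kn; by rewrite zz'// ltnW.
Qed.

Lemma measurable_ar_chain d (T : measurableType d) r x (z : nat -> T -> R) n :
  (forall i, (i < n)%N -> measurable_fun [set: T] (z i)) ->
  measurable_fun [set: T] (fun t => ar_chain r x (z^~ t) n).
Proof.
elim: n => [|n IH] mz /=; first exact: measurable_cst.
apply: measurable_funD; last exact: mz.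
by apply: measurable_funM => //; apply: IH => i /ltnW; exact: mz.
Qed.

Lemma measurable_ar_path d (T : measurableType d) r x (z : nat -> T -> R) n :
  (forall i, (i < n)%N -> measurable_fun [set: T] (z i)) ->
  measurable_fun [set: T] (fun t => ar_path r x (z^~ t) n).
Proof.
elim: n => [|n IH] mz; first exact: measurable_cst.
apply: measurable_cons; first exact: measurable_ar_chain.
by apply: IH => i /ltnW; exact: mz.
Qed.

Lemma measurable_nth n i : measurable_fun [set: n.-tuple R]
  (fun t : n.-tuple R => nth 0 t i).
Proof.
have [lt_in|le_ni] := ltnP i n.
  rewrite (_ : (fun _ => _) = (@tnth _ _)^~ (Ordinal lt_in)).
    exact: measurable_tnth.
  by apply/funext => t; rewrite (tnth_nth 0).
rewrite (_ : (fun _ => _) = cst 0); first exact: measurable_cst.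
by apply/funext => t; rewrite nth_default// size_tuple.
Qed.

(** The path up to step [n] is a measurable function of the first [n] noises. *)
Lemma independent_ar_path d (Omega : measurableType d)
    (P : probability Omega R) r x (Z : nat -> Omega -> R) n :
  (forall i, measurable_fun [set: Omega] (Z i)) ->
  (forall n, mutually_independent P (fun i : 'I_n => Z i)) ->
  independent_pair P (fun w => ar_path r x (Z^~ w) n) (Z n).
Proof.
move=> mZ iZ S B mS mB.
pose phi (t : n.-tuple R) := ar_path r x (nth 0 t) n.
have phiE w : ar_path r x (Z^~ w) n = phi (past Z n w).
  apply: eq_ar_path => k kn.
  by rewrite -(tnth_nth 0 _ (Ordinal kn)) tnth_mktuple.
have -> : (fun w => ar_path r x (Z^~ w) n) @^-1` S =
    past Z n @^-1` (phi @^-1` S).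
  by apply/seteqP; split => w /=; rewrite phiE.
apply: independent_past => //.
rewrite -[X in measurable X]setTI.
have mphi : measurable_fun [set: n.-tuple R] phi.
  apply: (@measurable_ar_path _ _ r x (fun i (t : n.-tuple R) => nth 0 t i)).
  by move=> i _; exact: measurable_nth.
exact: mphi.
Qed.

End ar_chain.

(** * Quadratic tilting of Gaussian walks *)

(** Completing the square in the exponent
    [- (y - w)^2 / (2 h) - s y^2 / 2]. The leftover factor in [w] is a Gaussian
    weight of the same form as the one that was absorbed, which is what allows
    this step to be iterated. *)
Lemma normal_pdf_tilt (R : realType) (h s w y : R) : 0 < h -> 0 <= s ->
  let r := (1 + h * s)^-1 in
  normal_pdf w (Num.sqrt h) y * expR (- (s * y ^+ 2) / 2) =
  Num.sqrt r * expR (- (s * r * w ^+ 2) / 2) *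
    normal_pdf (r * w) (Num.sqrt (h * r)) y.
Proof.
move=> h0 s0 r.
have hs0 : 0 < 1 + h * s by rewrite ltr_wpDr// mulr_ge0// ltW.
have r0 : 0 < r by rewrite invr_gt0.
have hr0 : 0 < h * r by rewrite mulr_gt0.
have sh : Num.sqrt h != 0 by rewrite gt_eqF// sqrtr_gt0.
have shr : Num.sqrt (h * r) != 0 by rewrite gt_eqF// sqrtr_gt0.
rewrite !normal_pdfE//= /normal_peak /normal_fun !sqr_sqrtr ?ltW//.
have -> : (Num.sqrt (h * r * pi *+ 2))^-1 =
    (Num.sqrt r)^-1 * (Num.sqrt (h * pi *+ 2))^-1.
  rewrite -invfM; congr (_^-1).
  rewrite -sqrtrM ?ltW//; congr Num.sqrt; ring.
set c := (Num.sqrt (h * pi *+ 2))^-1.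
have sr : Num.sqrt r != 0 by rewrite gt_eqF// sqrtr_gt0.
rewrite -[LHS]mulrA -expRD [RHS](_ : _ = c *
    (expR (- (s * r * w ^+ 2) / 2) *
     expR (- (y - r * w) ^+ 2 / (h * r *+ 2)))); last first.
  by rewrite !mulrA (mulrAC (Num.sqrt r)) divff// mul1r (mulrC _ c).
rewrite -expRD; congr (c * expR _).
have h0' := lt0r_neq0 h0; have hs0' := lt0r_neq0 hs0.
by rewrite /r; field; rewrite hs0' h0'.
Qed.

(** Throughout, [s k] is the coefficient of the square of the [k]-th value just
    before this value is integrated out, [r k] is the resulting ratio of the
    chain, and [q k] is the weight that the [k]-th value carries by itself:
    integrating out the next value contributes the remaining [s k.+1 * r k]. *)
Section tilt.
Context (R : realType) (h x : R) (s : nat -> R).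
Hypotheses (h0 : 0 < h) (s0 : forall k, 0 <= s k).
Notation r := (fun k => (1 + h * s k.+1)^-1).
Notation q := (fun k => s k - s k.+1 * (1 + h * s k.+1)^-1).
Context d (Omega : measurableType d) (P : probability Omega R)
  (Z : nat -> Omega -> R).
Hypothesis mZ : forall i, measurable_fun [set: Omega] (Z i).
Hypothesis iZ : forall n, mutually_independent P (fun i : 'I_n => Z i).
Hypothesis lawZ : forall n B, measurable B ->
  P (Z n @^-1` B) = normal_prob 0 (Num.sqrt h) B.
Context d' (Omega' : measurableType d') (P' : probability Omega' R)
  (Z' : nat -> Omega' -> R).
Hypothesis mZ' : forall i, measurable_fun [set: Omega'] (Z' i).
Hypothesis iZ' : forall n, mutually_independent P' (fun i : 'I_n => Z' i).
Hypothesis lawZ' : forall n B, measurable B ->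
  P' (Z' n @^-1` B) = normal_prob 0 (Num.sqrt (h * r n)) B.

Let hs0 k : 0 < 1 + h * s k. Proof. by rewrite ltr_wpDr// mulr_ge0// ltW. Qed.
Let r0 k : 0 < r k. Proof. by rewrite invr_gt0. Qed.
Let sqh0 : Num.sqrt h != 0. Proof. by rewrite gt_eqF// sqrtr_gt0. Qed.
Let sqhr0 k : Num.sqrt (h * r k) != 0.
Proof. by rewrite gt_eqF// sqrtr_gt0 mulr_gt0. Qed.

Definition energy n (t : n.+1.-tuple R) : R :=
  s n * nth 0 t 0 ^+ 2 + \sum_(i < n) q i * nth 0 t (n - i) ^+ 2.

(** The recursion behind the tilting step: apart from the square of the new
    value, appending it changes the energy by the multiple of the previous
    square that its integration gives back. *)
Lemma energy_cons n y (t : n.+1.-tuple R) :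
  energy [tuple of y :: t] =
  s n.+1 * y ^+ 2 + (energy t - s n.+1 * r n * nth 0 t 0 ^+ 2).
Proof.
rewrite /energy/= big_ord_recr/= subSn// subnn/=.
under eq_bigr => i _ do rewrite subSn ?(ltnW (ltn_ord i))//=.
ring.
Qed.

Lemma measurable_energy n : measurable_fun [set: n.+1.-tuple R] (@energy n).
Proof.
apply: measurable_funD.
  apply: measurable_funM => //; apply: measurable_funX; exact: measurable_nth.
apply: measurable_sum => i; apply: measurable_funM => //.
by apply: measurable_funX; exact: measurable_nth.
Qed.

Definition tilt_cst n : R :=
  expR (- (s 0%N * x ^+ 2) / 2) * \prod_(k < n) Num.sqrt (r k).

Lemma tilt_cst_gt0 n : 0 < tilt_cst n.
Proof.
by rewrite mulr_gt0 ?expR_gt0// prodr_gt0// => k _; rewrite sqrtr_gt0.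
Qed.

Let one : nat -> R := fun=> 1.

(** [normal_pdf_tilt] under the integral sign: the weight of the longer path
    turns into the weight of the shorter one. *)
Lemma one_step_tilt n (F : n.+2.-tuple R -> \bar R) (t : n.+1.-tuple R) :
  measurable_fun [set: n.+2.-tuple R] F -> (forall t, (0 <= F t)%E) ->
  (\int[normal_prob 0 (Num.sqrt h)]_z
     (F [tuple of (nth 0 t 0 + z)%R :: t] *
      (expR (- energy [tuple of (nth 0 t 0 + z)%R :: t] / 2))%:E) =
   (Num.sqrt (r n))%:E * (expR (- energy t / 2))%:E *
   \int[normal_prob 0 (Num.sqrt (h * r n))]_z
     F [tuple of (r n * nth 0 t 0 + z)%R :: t])%E.
Proof.
move=> mF F0; set c := nth 0 t 0.
have mcons : measurable_fun [set: R]
    (fun y => [tuple of y :: t] : n.+2.-tuple R).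
  exact: measurable_cons.
have mFc : measurable_fun [set: R] (fun y => F [tuple of y :: t]).
  exact: measurableT_comp.
pose f y :=
  (F [tuple of y :: t] * (expR (- energy [tuple of y :: t] / 2))%:E)%E.
have mf : measurable_fun [set: R] f.
  apply: emeasurable_funM => //; apply/measurable_EFinP.
  apply: measurableT_comp => //; apply: measurable_funM => //.
  apply: measurableT_comp => //.
  by apply: measurableT_comp mcons; exact: measurable_energy.
have f0 y : (0 <= f y)%E by rewrite mule_ge0// lee_fin expR_ge0.
rewrite [LHS](ge0_integral_normal_prob_shift c sqh0 mf f0).
rewrite (ge0_integral_normal_prob_shift (r n * c) (sqhr0 n) mFc); last first.
  by move=> y; exact: F0.
rewrite -ge0_integralZl; last 4 first.
- exact: measurableT.
- apply: emeasurable_funM => //; apply/measurable_EFinP.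
  exact: measurable_normal_pdf.
- by move=> y _; rewrite mule_ge0// lee_fin normal_pdf_ge0.
- by rewrite mule_ge0// lee_fin ?sqrtr_ge0 ?expR_ge0.
apply: eq_integral => y _.
rewrite /f -[LHS]muleA -EFinM -[in RHS]EFinM [RHS]muleCA -[in RHS]EFinM.
congr (_ * _%:E)%E; rewrite energy_cons -/c.
have := normal_pdf_tilt c y h0 (s0 n.+1).
cbv zeta => E.
rewrite [X in expR X](_ : _ = - (s n.+1 * y ^+ 2) / 2 +
  (- energy t / 2 + s n.+1 * r n * c ^+ 2 / 2)); last by ring.

rewrite expRD mulrAC mulrC mulrA -[in LHS]mulrA [in LHS]mulrC.
rewrite [X in X * _](mulrC _ (normal_pdf _ _ _)) E expRD.
rewrite [X in _ * _ * _ * (_ * X) = _](_ : _ =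
  (expR (- (s n.+1 * r n * c ^+ 2) / 2))^-1); last first.
  by rewrite -expRN; congr expR; ring.
by field; rewrite gt_eqF// expR_gt0.
Qed.

(** Induction on the length, for all [F] at once: the last increment of the walk
    is integrated out by [one_step_tilt], the induction hypothesis applies to
    the resulting function of the shorter path, and the same integral is then
    recognised as the integration of the last increment of the chain. *)
Lemma tilted_expectation n (F : n.+1.-tuple R -> \bar R) :
  measurable_fun [set: n.+1.-tuple R] F -> (forall t, (0 <= F t)%E) ->
  (\int[P]_w (F (ar_path one x (Z^~ w) n) *
      (expR (- energy (ar_path one x (Z^~ w) n) / 2))%:E) =
   (tilt_cst n)%:E * \int[P']_w F (ar_path r x (Z'^~ w) n))%E.
Proof.
elim: n F => [|n IH] F mF F0.
  rewrite /= !integral_cst//= !probability_setT !mule1 muleC; congr (_ * _)%E.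
  by rewrite /tilt_cst /energy !big_ord0 addr0 mulr1.
have mpath := measurable_ar_path.
pose g (tz : n.+1.-tuple R * R) :=
  (F [tuple of (nth 0%R tz.1 0 + tz.2)%R :: tz.1] *
   (expR (- energy [tuple of (nth 0%R tz.1 0 + tz.2)%R :: tz.1] / 2))%:E)%E.
have mnth : measurable_fun [set: n.+1.-tuple R * R] (fun tz => nth 0 tz.1 0).
  apply: (@measurableT_comp _ _ _ _ _ _
    (fun t : n.+1.-tuple R => nth 0 t 0)) => //.
  exact: measurable_nth.
have mcons (a : R) : measurable_fun [set: n.+1.-tuple R * R]
   (fun tz => [tuple of (a * nth 0%R tz.1 0 + tz.2)%R :: tz.1] : n.+2.-tuple R).
  apply: measurable_cons => //; apply: measurable_funD => //.
  exact: measurable_funM.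
have mcons1 : measurable_fun [set: n.+1.-tuple R * R]
   (fun tz => [tuple of (nth 0%R tz.1 0 + tz.2)%R :: tz.1] : n.+2.-tuple R).
  by apply: eq_measurable_fun (mcons 1) => tz _ /=; rewrite mul1r.
have mg : measurable_fun [set: n.+1.-tuple R * R] g.
  apply: emeasurable_funM; first exact: measurableT_comp.
  apply/measurable_EFinP; apply: measurableT_comp => //.
  apply: measurable_funM => //; apply: measurableT_comp => //.
  by apply: measurableT_comp mcons1; exact: measurable_energy.
have g0 tz : (0 <= g tz)%E by rewrite mule_ge0// lee_fin expR_ge0.
transitivity (\int[P]_w g (ar_path one x (Z^~ w) n, Z n w))%E.
  apply: eq_integral => w _.
  by rewrite /g /= !nth0_ar_path /one mul1r.
rewrite (ge0_expectation_indep
  (nu := normal_prob 0 (Num.sqrt h) : probability (measurableTypeR R) R)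
  _ (mZ n)
  (independent_ar_path one x (n := n) mZ iZ)
  (lawZ n) mg g0); last by apply: mpath => i _.
(* F' is F with its last increment averaged out under the tilted transition *)
pose F' (t : n.+1.-tuple R) := (\int[normal_prob 0 (Num.sqrt (h * r n))]_z
     F [tuple of (r n * nth 0 t 0 + z)%R :: t])%E.
have mFr : measurable_fun [set: n.+1.-tuple R * R]
    (fun tz => F [tuple of (r n * nth 0%R tz.1 0 + tz.2)%R :: tz.1]).
  by apply: measurableT_comp => //; exact: mcons.
have mF' : measurable_fun [set: n.+1.-tuple R] F'.
  exact: (@measurable_fun_fubini_tonelli_F _ _ (n.+1.-tuple R)
    (measurableTypeR R) R (normal_prob 0 (Num.sqrt (h * r n))) _ mFr
    (fun tz => F0 _)).
have F'0 t : (0 <= F' t)%E by apply: integral_ge0 => z _; exact: F0.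
transitivity (\int[P]_w ((Num.sqrt (r n))%:E *
    (F' (ar_path one x (Z^~ w) n) *
     (expR (- energy (ar_path one x (Z^~ w) n) / 2))%:E)))%E.
  apply: eq_integral => w _.
  by rewrite /g (one_step_tilt _ mF F0) -muleA (muleC (F' _)).
rewrite ge0_integralZl; last 4 first.
- exact: measurableT.
- have mp : measurable_fun [set: Omega] (fun w => ar_path one x (Z^~ w) n).
    by apply: mpath => i _.
  apply: emeasurable_funM; first exact: measurableT_comp.
  apply/measurable_EFinP; apply: measurableT_comp => //.
  apply: measurable_funM => //; apply: measurableT_comp => //.
  by apply: measurableT_comp mp; exact: measurable_energy.
- by move=> w _; rewrite mule_ge0// lee_fin expR_ge0.
- by rewrite lee_fin sqrtr_ge0.
rewrite (IH F' mF' F'0) muleA -EFinM.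
have -> : Num.sqrt (r n) * tilt_cst n = tilt_cst n.+1.
  by rewrite /tilt_cst big_ord_recr/=; ring.
congr (_ * _)%E; apply/esym.
pose g' (tz : n.+1.-tuple R * R) :=
  F [tuple of (r n * nth 0%R tz.1 0 + tz.2)%R :: tz.1].
transitivity (\int[P']_w g' (ar_path r x (Z'^~ w) n, Z' n w))%E.
  by apply: eq_integral => w _; rewrite /g' /= nth0_ar_path.
rewrite (ge0_expectation_indep
  (nu := normal_prob 0 (Num.sqrt (h * r n)) :
    probability (measurableTypeR R) R) _ (mZ' n)
  (independent_ar_path r x (n := n) mZ' iZ')
  (lawZ' n) mFr)//; last by apply: mpath => i _.
Qed.

End tilt.

(** * Continuous functions on a segment *)

Section real_line.
Context (R : realType).
Implicit Types (f : R -> R).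
Notation mu := (@lebesgue_measure R).

(** Compactness in its near-covering form, with the modulus [del] as the
    parameter. *)
Lemma heine f (S e : R) : continuous f -> 0 < e ->
  exists2 del, 0 < del & forall u v, 0 <= u <= S -> 0 <= v <= S ->
    `|u - v| <= del -> `|f u - f v| <= e.
Proof.
move=> cf e0.
have /compact_near_coveringP/(_ R (0 : R)^'+
   (fun del u => forall v, `|u - v| <= del -> `|f u - f v| <= e) _) :
   compact `[0, S] by exact: segment_compact.
case=> [u _|].
  have e20 : 0 < e / 2 by rewrite divr_gt0.
  have /cvgrPdist_le/(_ _ e20)/nbhs_ballP[rho /= rho0 frho] := cf u.
  exists (ball u (rho / 2), [set del | del < rho / 2]).
    split; first by apply: nbhsx_ballx; rewrite divr_gt0.
    by apply: nbhs_right_lt; rewrite divr_gt0.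
  move=> [u' del] /= [uu' drho] v u'v.
  rewrite (_ : f u' - f v = (f u - f v) - (f u - f u')); last by ring.
  rewrite (le_trans (ler_normB _ _))// [leRHS]splitr lerD//; apply: frho.
    rewrite /ball/= (_ : u - v = (u - u') + (u' - v)); last by ring.
    rewrite (le_lt_trans (ler_normD _ _))// [ltRHS]splitr ltrD//.
    exact: le_lt_trans drho.
  by apply: lt_trans uu' _; rewrite ltr_pdivrMr// ltr_pMr// ltr1n.
move=> _ /posnumP[rho]; move/(_ (rho%:num / 2)) => H.
exists (rho%:num / 2); first by [].
move=> u v uS _; apply: H => //=.
by rewrite sub0r normrN gtr0_norm// ltr_pdivrMr// ltr_pMr// ltr1n.

Qed.

Lemma bounded_on_segment f (S : R) : continuous f ->
  exists2 K, 0 <= K & forall u, 0 <= u <= S -> `|f u| <= K.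
Proof.
move=> cf; have /compact_bounded[N [_ Nb]] : compact (f @` `[0, S] : set R^o).
  apply: continuous_compact; last exact: segment_compact.
  exact: continuous_subspaceT.
exists (`|N| + 1) => [|u uS]; first by rewrite addr_ge0.
apply: Nb; first by rewrite (le_lt_trans (ler_norm _))// ltrDl.
by exists u => //=; rewrite in_itv.
Qed.

Lemma continuous_integrable f (a b : R) : continuous f ->
  mu.-integrable `[a, b] (EFin \o f).
Proof.
move=> cf; apply: continuous_compact_integrable; first exact: segment_compact.
exact: continuous_subspaceT.
Qed.

Lemma Rintegral_increment f (a b : R) : continuous f -> 0 <= a -> a <= b ->
  (\int[mu]_(s in `[0%R, b]) f s - \int[mu]_(s in `[0%R, a]) f s =
   \int[mu]_(s in `[a, b]) f s)%R.
Proof.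
move=> cf a0 ab.
rewrite Rintegral_itvB; last 3 first.
- exact: continuous_integrable.
- by rewrite bnd_simp.
- by rewrite bnd_simp.
rewrite Rintegral_itv_obnd_cbnd//.
apply: integrableS (continuous_integrable a b cf) => //.
exact: subset_itv_oc_cc.
Qed.

Lemma Rintegral_near_cst f (a b c e : R) : continuous f -> a <= b ->
  (forall s, a <= s <= b -> `|f s - c| <= e) ->
  `|\int[mu]_(s in `[a, b]) f s - (b - a) * c| <= (b - a) * e.
Proof.
move=> cf ab fe.
have ic (k : R) : mu.-integrable `[a, b] (EFin \o cst k).
  by apply: continuous_integrable => u; exact: cvg_cst.
have cstE (k : R) : (\int[mu]_(s in `[a, b]) k)%R = (b - a) * k.
  have := @Rintegral_cst _ _ _ mu `[a, b] (measurable_itv _) k.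
  rewrite /cst => ->; rewrite /= lebesgue_measure_itv/= lte_fin.
  by move: ab; rewrite le_eqVlt => /predU1P[->|->];
    rewrite ?ltxx ?subrr ?mul0r ?mulr0//= mulrC.
rewrite -!cstE -RintegralB//; [|exact: continuous_integrable|exact: ic].
have cfc : continuous (fun s => f s - c).
  by move=> s; apply: cvgB; [exact: cf|exact: cvg_cst].
apply: le_trans (le_normr_Rintegral _ _) _ => //.
  exact: continuous_integrable cfc.
apply: le_Rintegral => //.
- apply: continuous_integrable => s.
  by apply: cvg_norm; exact: cfc.
- exact: ic.
Qed.

End real_line.

(** * Convergence of paths and interpolation *)

Section pathspace_convergence.
Context (R : realType).

(** A compact subset of the half-line is bounded, so uniform convergence on
    segments is enough. *)
Lemma pathspace_cvg (w : pathspace R) (v : nat -> pathspace R) :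
  (forall S e : R, 0 < e -> \forall n \near \oo, forall t, 0 <= t <= S ->
     `|eval_at w t - eval_at (v n) t| <= e) ->
  v n @[n --> \oo] --> w.
Proof.
move=> wv.
suff : ((v n : {family compact, halfline R -> R}) @[n --> \oo] -->
    (w : {family compact, halfline R -> R})).
  move=> vw A; rewrite nbhsE => -[_ [[C oC <-] Cw] CA].
  by apply: filterS CA _; apply: vw; exact: open_nbhs_nbhs.
apply/fam_cvgP => K cK P /uniform_nbhs[E [entE EP]].
have [e /= e0 eE] : exists2 e : R, 0 < e &
    [set xy : R * R | ball xy.1 e xy.2] `<=` E.
  by move: entE; rewrite -entourage_ballE => -[e e0 H]; exists e.
have [S KS] : exists S, forall u : halfline R, K u -> set_val u <= S.
  have /compact_bounded[N [_ Nb]] :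
      compact ((set_val : halfline R -> R^o) @` K).
    apply: continuous_compact => //; apply: continuous_subspaceT.
    exact: initial_continuous.
  exists (`|N| + 1) => u Ku.
  rewrite (le_trans (ler_norm _))//; apply: Nb; last by exists u.
  by rewrite (le_lt_trans (ler_norm _))// ltrDl.
have e20 : 0 < e / 2 by rewrite divr_gt0.
apply: filterS (wv S _ e20) => n wvn; apply: EP => u Ku; apply: eE.
have u0 : 0 <= set_val u.
  by have := valP u; rewrite inE/= in_itv/= andbT set_valE.
have uE : clip (set_val u) = u.
  by apply: val_inj; rewrite /= -set_valE; exact/max_idPr.
have := wvn (set_val u); rewrite u0 (KS _ Ku) /eval_at uE => /(_ isT) wu.
by rewrite /ball/= (le_lt_trans wu)// ltr_pdivrMr// ltr_pMr// ltr1n.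
Qed.

End pathspace_convergence.

Section interpolation.
Context (R : realType).
Implicit Types (h : R) (y : nat -> R).

Definition clamp (u : R) : R := Num.min 1 (Num.max 0 u).

(** Piecewise linear interpolation of the points [(k * h, y k)], constant after
    time [M * h]; as a sum of clamped ramps it is visibly continuous. *)
Definition interp h (M : nat) y (t : R) : R :=
  y 0%N + \sum_(k < M) (y k.+1 - y k) * clamp (t / h - k%:R).

Lemma continuous_clamp : continuous clamp.
Proof.
move=> u; apply: continuous_min; first exact: cvg_cst.
by apply: continuous_max; [exact: cvg_cst|exact: cvg_id].
Qed.

Lemma continuous_interp h M y : continuous (interp h M y).
Proof.
move=> t; apply: cvgD; first exact: cvg_cst.
elim: M => [|M IH].
  by under eq_fun do rewrite big_ord0; rewrite big_ord0; exact: cvg_cst.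
under eq_fun do rewrite big_ord_recr/=; rewrite big_ord_recr/=.
apply: cvgD; first exact: IH.
apply: cvgM; first exact: cvg_cst.
apply: (@cvg_comp _ _ _ (fun t => t / h - M%:R) clamp (nbhs t)
  (nbhs (t / h - M%:R))); last first.
  exact: continuous_clamp.
apply: cvgB; last exact: cvg_cst.
by apply: cvgM; [exact: cvg_id|exact: cvg_cst].
Qed.

Lemma continuous_interp_halfline h M y :
  continuous (fun u : halfline R => interp h M y (set_val u)).
Proof.
move=> u; apply: (@continuous_comp _ _ _ set_val (interp h M y));
  last exact: continuous_interp.
exact: initial_continuous.
Qed.

Definition interp_path h M y : pathspace R :=
  mkcts (@continuous_interp_halfline h M y).

Lemma eval_at_interp_path h M y t : 0 <= t ->
  eval_at (interp_path h M y) t = interp h M y t.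
Proof.
move=> t0; rewrite /eval_at/= /mkcts set_valE/= /clip/=.
by congr interp; exact/max_idPr.
Qed.

Lemma interp_between h M y k t : 0 < h -> (k < M)%N ->
  k%:R * h <= t <= k.+1%:R * h ->
  interp h M y t = y k + (y k.+1 - y k) * (t / h - k%:R).
Proof.
move=> h0 kM /andP[kt tk].
have kth : 0 <= t / h - k%:R by rewrite subr_ge0 ler_pdivlMr.
have tkh : t / h - k%:R <= 1.
  by rewrite lerBlDr ler_pdivrMr// addrC natr1.
have clamp1 (u : R) : 1 <= u -> clamp u = 1.
  by move=> u1; apply/min_idPl; rewrite le_max u1 orbT.
have clamp0 (u : R) : u <= 0 -> clamp u = 0.
  by move=> u0; rewrite /clamp; move/max_idPl : u0 => ->; apply/min_idPr.
rewrite /interp -(big_mkord xpredT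
  (fun i => (y i.+1 - y i) * clamp (t / h - i%:R))).
rewrite (big_cat_nat _ (n := k)) //=; last exact: ltnW.
rewrite [X in _ + (_ + X)]big_ltn//= [X in _ + (_ + (_ + X))]big1_seq ?addr0;
  last first.
  move=> i /andP[_]; rewrite mem_index_iota => /andP[ki _].
  rewrite clamp0 ?mulr0// subr_le0 (le_trans _ (_ : k.+1%:R <= _))//.
    by rewrite ler_pdivrMr.
  by rewrite ler_nat.
rewrite (eq_big_nat _ _ (F2 := fun i => y i.+1 - y i)); last first.
  move=> i /andP[_ ik]; rewrite clamp1 ?mulr1// lerBrDr.
  rewrite (le_trans _ (_ : k%:R <= _))//; last by rewrite ler_pdivlMr.
  by rewrite addrC natr1 ler_nat.
rewrite telescope_sumr// addrA subrKC; congr (_ + _ * _).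
rewrite /clamp; move/max_idPr : kth => ->.
exact/min_idPr.
Qed.

Lemma dist_convex (a b c th e : R) : 0 <= th <= 1 ->
  `|c - a| <= e -> `|c - b| <= e -> `|c - (a + (b - a) * th)| <= e.
Proof.
move=> /andP[t0 t1] ca cb.
(* the distance to a convex combination is at most the larger one *)
rewrite (_ : _ - _ = (1 - th) * (c - a) + th * (c - b)); last by ring.
rewrite (le_trans (ler_normD _ _))// !normrM (ger0_norm t0).
rewrite ger0_norm ?subr_ge0//.
rewrite (_ : e = (1 - th) * e + th * e); last by ring.
by rewrite lerD// ler_wpM2l// subr_ge0.
Qed.

Lemma cell_index h t : 0 < h -> 0 <= t ->
  exists k : nat, k%:R * h <= t <= k.+1%:R * h.
Proof.
move=> h0 t0; exists (Num.trunc (t / h)).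
have th0 : 0 <= t / h by rewrite divr_ge0// ltW.
have /andP[a b] := truncn_itv th0.
by rewrite -ler_pdivlMr// a/= -ler_pdivrMr// ltW.
Qed.

(** The values of the interpolation are convex combinations of two consecutive
    values of [y], both close to the values of [w] at nearby times. *)
Lemma interp_path_cvg (w : pathspace R) (h : nat -> R) (M : nat -> nat)
    (y : nat -> nat -> R) :
  (forall n, 0 < h n) -> h n @[n --> \oo] --> (0 : R) ->
  (M n)%:R * h n @[n --> \oo] --> +oo ->
  (forall S e : R, 0 < e -> \forall n \near \oo,
     forall k, k%:R * h n <= S -> `|eval_at w (k%:R * h n) - y n k| <= e) ->
  interp_path (h n) (M n) (y n) @[n --> \oo] --> w.
Proof.
move=> h0 hcvg Mh yw; apply: pathspace_cvg => S e e0.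
have e20 : 0 < e / 2 by rewrite divr_gt0.
have [del del0 wdel] := heine (S + 1) (@continuous_eval_at _ w) e20.
have del10 : 0 < Num.min 1 del by rewrite lt_min ltr01.
have hdel : \forall n \near \oo, h n <= Num.min 1 del.
  have /cvgrPdist_le/(_ _ del10) := hcvg.
  by apply: filterS => n; rewrite sub0r normrN gtr0_norm.
have MS : \forall n \near \oo, S < (M n)%:R * h n.
  by move/cvgryPgt : Mh => /(_ S).
near=> n => t /andP[t0 tS].
rewrite eval_at_interp_path//.
have [k /andP[kt tk]] := cell_index (h0 n) t0.
have hn : h n <= Num.min 1 del by near: n.
have hn1 : h n <= 1 by rewrite (le_trans hn)// ge_min lexx.
have hnd : h n <= del by rewrite (le_trans hn)// ge_min lexx orbT.
have kM : (k < M n)%N.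
  have : k%:R * h n < (M n)%:R * h n.
    by rewrite (le_lt_trans kt)// (le_lt_trans tS)//; near: n.
  by rewrite ltr_pM2r// ltr_nat.
have kSh : k.+1%:R * h n = k%:R * h n + h n by rewrite -natr1 mulrDl mul1r.
have k1S : k.+1%:R * h n <= S + 1.
  by rewrite kSh lerD// (le_trans kt).
have kh0 : 0 <= k%:R * h n by rewrite mulr_ge0// ltW.
have yn : forall k, k%:R * h n <= S + 1 ->
    `|eval_at w (k%:R * h n) - y n k| <= e / 2.
  by near: n; exact: yw.
rewrite (interp_between _ (h0 n) kM) ?kt//.
have Hk : k%:R * h n <= S + 1 by rewrite (le_trans _ k1S)// kSh lerDl ltW.
apply: dist_convex.
- rewrite subr_ge0 ler_pdivlMr// kt/= lerBlDr ler_pdivrMr//.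
  by rewrite addrC natr1.
- rewrite (_ : _ - _ = (eval_at w t - eval_at w (k%:R * h n)) +
    (eval_at w (k%:R * h n) - y n k)); last by ring.
  rewrite (le_trans (ler_normD _ _))// [leRHS]splitr lerD//; last exact: yn.
  apply: wdel.
  + by rewrite t0 (le_trans tS)// lerDl.
  + by rewrite kh0.
  + rewrite ger0_norm ?subr_ge0// lerBlDr (le_trans tk)// kSh addrC.
    by rewrite lerD2r.
- rewrite (_ : _ - _ = (eval_at w t - eval_at w (k.+1%:R * h n)) +
    (eval_at w (k.+1%:R * h n) - y n k.+1)); last by ring.
  rewrite (le_trans (ler_normD _ _))// [leRHS]splitr lerD//; last exact: yn.
  apply: wdel.
  + by rewrite t0 (le_trans tS)// lerDl.
  + by rewrite k1S mulr_ge0// ltW.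
  + rewrite ler0_norm ?subr_le0// opprB lerBlDr kSh addrC lerD//.
Unshelve. all: by end_near. Qed.

End interpolation.

(** * Riemann sums *)

Section riemann_sum.
Context (R : realType).
Notation mu := (@lebesgue_measure R).
Implicit Types (f : R -> R).

Lemma dist_Rintegral_left_sum f (h e : R) n : continuous f -> 0 < h ->
  (forall k s, (k < n)%N -> k%:R * h <= s <= k.+1%:R * h ->
     `|f s - f (k%:R * h)| <= e) ->
  `|\int[mu]_(s in `[0%R, n%:R * h]) f s - h * \sum_(k < n) f (k%:R * h)| <=
  n%:R * h * e.
Proof.
move=> cf h0; elim: n => [|n IH] fe.
  by rewrite big_ord0 mul0r set_itv1 Rintegral_set1 mulr0 subr0 normr0 mul0r.
rewrite big_ord_recr/=.
have nh0 : 0 <= n%:R * h by rewrite mulr_ge0// ltW.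
have nnh : n%:R * h <= n.+1%:R * h by rewrite ler_pM2r// ler_nat.
have D := Rintegral_increment cf nh0 nnh.
have nS : n.+1%:R * h - n%:R * h = h by rewrite -natr1; ring.
have N := Rintegral_near_cst cf nnh (fe n ^~ (ltnSn n)).
rewrite nS -D in N.
have {}IH := IH (fun k s kn => fe k s (ltnW kn)).
set I1 := (\int[mu]_(s in `[0%R, n.+1%:R * h]) f s)%R in N *.
set I0 := (\int[mu]_(s in `[0%R, n%:R * h]) f s)%R in N IH.
rewrite (_ : I1 - _ = (I0 - h * \sum_(k < n) f (k%:R * h)) +
  (I1 - I0 - h * f (n%:R * h))); last by ring.
rewrite (le_trans (ler_normD _ _))//.
rewrite (_ : n.+1%:R * h * e = n%:R * h * e + h * e).
  exact: lerD.
by rewrite -natr1; ring.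
Qed.

Lemma left_sum_cvg f (T : R) : continuous f -> 0 < T ->
  (T / n.+1%:R) * \sum_(k < n.+1) f (k%:R * (T / n.+1%:R)) @[n --> \oo] -->
  (\int[mu]_(s in `[0%R, T]) f s)%R.
Proof.
move=> cf T0; apply/cvgrPdist_le => e e0.
have eT0 : 0 < e / T by rewrite divr_gt0.
have [del del0 fdel] := heine T cf eT0.
have hdel : \forall n \near \oo, T / n.+1%:R <= del.
  near=> n; rewrite ler_pdivrMr// mulrC -ler_pdivrMr//.
  rewrite (@le_trans _ _ n%:R) ?ler_nat//.
  by near: n; exact: nbhs_infty_ger.
near=> n.
have h0 : 0 < T / n.+1%:R by rewrite divr_gt0.
have nh : n.+1%:R * (T / n.+1%:R) = T.
  by rewrite mulrCA divff ?mulr1// pnatr_eq0.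
have := @dist_Rintegral_left_sum f (T / n.+1%:R) (e / T) n.+1 cf h0.
rewrite nh mulrCA divff ?mulr1 ?gt_eqF//; apply.
move=> k s kn /andP[ks sk].
have kT : k%:R * (T / n.+1%:R) <= T.
  by rewrite -[leRHS]nh ler_pM2r// ler_nat ltnW.
have k0 : 0 <= k%:R * (T / n.+1%:R) by rewrite mulr_ge0// ltW.
apply: fdel.
- rewrite (le_trans k0 ks)/= (le_trans sk)// -[leRHS]nh ler_pM2r// ler_nat//.
- by rewrite k0.
- rewrite ger0_norm ?subr_ge0// (le_trans (lerB sk (lexx _)))//.
  rewrite -mulrBl -natr1 addrAC subrr add0r mul1r.
  by near: n.
Unshelve. all: by end_near. Qed.

End riemann_sum.

(** * The Riccati recursion *)

Section riccati.
Context (R : realType).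
Implicit Types e : R.

(** The index counts the steps left before the horizon: with [e = gamma * h],
    the coefficient of the [k]-th square is [riccati e (N - k) / h]. The
    truncated subtraction makes it vanish from the horizon on. *)
Fixpoint riccati e (j : nat) : R :=
  if j is i.+1 then e ^+ 2 + riccati e i / (1 + riccati e i) else 0.

Lemma riccati_ge0 e j : 0 <= riccati e j.
Proof.
elim: j => //= j IH; rewrite addr_ge0 ?sqr_ge0// divr_ge0// addr_ge0//.
Qed.

Lemma riccati_fixpoint e : 0 <= e ->
  exists2 A, e <= A <= e + e ^+ 2 & A ^+ 2 = e ^+ 2 * (1 + A).
Proof.
move=> e0; set q := Num.sqrt (e ^+ 2 + 4).
have q0 : 0 <= q by exact: sqrtr_ge0.
have qq : q ^+ 2 = e ^+ 2 + 4 by rewrite sqr_sqrtr// addr_ge0// sqr_ge0.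
have q2 : 2 <= q.
  rewrite -(@ler_pXn2r _ 2)// ?nnegrE// qq.
  by have := sqr_ge0 e; lra.
have qe : q <= 2 + e.
  rewrite -(@ler_pXn2r _ 2)// ?nnegrE ?addr_ge0// qq.
  by rewrite sqrrD; nra.
(* the positive root of A^2 - e^2 A - e^2 *)
exists ((e ^+ 2 + e * q) / 2).
  by apply/andP; split; nra.
have -> : ((e ^+ 2 + e * q) / 2) ^+ 2 =
    (e ^+ 4 + 2 * e ^+ 3 * q + e ^+ 2 * q ^+ 2) / 4 by field.
by rewrite qq; field.
Qed.

(** One step of the recursion divides the distance to the fixed point by
    [(1 + a) * (1 + A)], and dividing [A / (1 + j A)] by [1 + A] gives at most
    [A / (1 + (j + 1) A)]. *)
Lemma riccati_near_fixpoint e A j : 0 <= A -> A ^+ 2 = e ^+ 2 * (1 + A) ->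
  `|riccati e j - A| <= A / (1 + j%:R * A).
Proof.
move=> A0 AE; have A1 : 0 < 1 + A by rewrite ltr_pwDl.
elim: j => [|j IH] /=.
  by rewrite mul0r addr0 divr1 sub0r normrN ger0_norm.
have a0 := riccati_ge0 e j; set a := riccati e j in a0 IH *.
have a1 : 0 < 1 + a by rewrite ltr_pwDl.
have jA : 0 < 1 + j%:R * A by rewrite ltr_pwDl// mulr_ge0.
have eE : e ^+ 2 = A - A / (1 + A).
  by apply: (mulIf (lt0r_neq0 A1)); rewrite -AE; field; rewrite gt_eqF.
rewrite (_ : _ - A = (a - A) / ((1 + a) * (1 + A))); last first.
  by rewrite eE; field; rewrite !gt_eqF.
rewrite normrM normfV (gtr0_norm (mulr_gt0 a1 A1)).
rewrite ler_pdivrMr ?mulr_gt0//.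
rewrite (le_trans IH)// -mulrA ler_wpM2l//.
rewrite -[leLHS]mul1r ler_pdivrMr// [leRHS](_ : _ =
  (1 + j%:R * A) * ((1 + a) * (1 + A)) / (1 + j.+1%:R * A)); last by ring.
rewrite ler_pdivlMr ?mul1r; last by rewrite ltr_pwDl// mulr_ge0.
rewrite -natr1.
have : 0 <= j%:R * A by rewrite mulr_ge0.
set J := j%:R.
move=> JA.
have : 0 <= J * A * A by rewrite mulr_ge0.
have : 0 <= J * A * A * a by rewrite !mulr_ge0.
have : 0 <= J * A * a by rewrite !mulr_ge0.
have : 0 <= A * a by rewrite !mulr_ge0.
nra.
Qed.

(** The fixed point is [e + O(e^2)], so the ratio [(1 + riccati e j)^-1] is
    [1 - e + o(e)] as soon as [e] is small and [j * e] is large, that is, at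
    macroscopic distance from the horizon. *)
Lemma riccati_rate e j : 0 < e -> e <= 1 ->
  `|1 - (1 + riccati e j)^-1 - e| <= e * (17 * e + 2 / (1 + j%:R * e)).
Proof.
move=> e0 e1.
have [A /andP[eA Ae] AE] := riccati_fixpoint (ltW e0).
have A0 : 0 <= A by rewrite (le_trans _ eA)// ltW.
have := riccati_near_fixpoint j A0 AE.
have := riccati_ge0 e j; set a := riccati e j => a0 aA.
have je : 0 < 1 + j%:R * e by rewrite ltr_pwDl// mulr_ge0// ltW.
have jA : 0 < 1 + j%:R * A by rewrite ltr_pwDl// mulr_ge0.
have ee : e ^+ 2 <= e by rewrite expr2 ler_piMr// ltW.
have bnd : A / (1 + j%:R * A) <= e * (2 / (1 + j%:R * e)).
  rewrite mulrA ler_pM//; first by rewrite invr_ge0 ltW.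
    by rewrite (le_trans Ae)//; lra.
  by rewrite lef_pV2// lerD2l ler_wpM2l.
set b := e * (2 / (1 + j%:R * e)) in bnd.
have b2 : b <= 2 * e.
  rewrite /b mulrC ler_wpM2r ?(ltW e0)// ler_pdivrMr// ler_peMr//.
  by rewrite lerDl mulr_ge0// ltW.
have aAb := le_trans aA bnd.
have a1 : 0 < 1 + a by rewrite ltr_pwDl.
have a4 : a <= 4 * e.
  by move: aAb; rewrite ler_norml => /andP[_]; lra.
rewrite mulrDr -/b.
rewrite (_ : 1 - _ - e = (a - A) + (A - e) - a ^+ 2 / (1 + a)); last first.
  by field; rewrite gt_eqF.
rewrite (le_trans (ler_normB _ _))//.
have aa : `|a ^+ 2 / (1 + a)| <= 16 * e ^+ 2.
  rewrite ger0_norm ?divr_ge0 ?sqr_ge0 ?(ltW a1)//.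
  rewrite (le_trans (_ : _ <= a ^+ 2))//.
    by rewrite ler_pdivrMr// ler_peMr ?sqr_ge0// lerDl.
  rewrite (_ : 16 * e ^+ 2 = (4 * e) ^+ 2); last by ring.
  by rewrite ler_pXn2r ?nnegrE// mulr_ge0// ltW.
have AA : `|A - e| <= e ^+ 2 by rewrite ger0_norm ?subr_ge0//; lra.
have := ler_normD (a - A) (A - e).
rewrite !expr2 in aa AA *.
by lra.
Qed.

End riccati.

(** * An Euler scheme for the Ornstein-Uhlenbeck equation *)

Section ou_scheme.
Context (R : realType).
Notation mu := (@lebesgue_measure R).

(** The times at which the driving Brownian motion is sampled: its increments
    then have exactly the variances [h * r k] produced by the tilting. *)
Definition clock (h : R) (r : nat -> R) (k : nat) : R := h * \sum_(i < k) r i.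

(** Compare [Y k - B (clock k)] with [X (k h) - B (k h)]: the noise cancels, and
    the difference is multiplied by [r k <= 1] at each step up to an error of
    order [h]. The errors therefore merely add up. *)
Lemma ou_scheme_error (X B : R -> R) (gamma h eta omega K : R)
    (r : nat -> R) (n : nat) :
  continuous X -> 0 < gamma -> 0 < h -> 0 <= eta -> 0 <= omega -> 0 <= K ->
  (forall t, 0 <= t ->
    X t = X 0 + B t - gamma * (\int[mu]_(s in `[0%R, t]) X s)%R) ->
  (forall k, 0 <= r k <= 1) ->
  (forall k, (k < n)%N -> `|1 - r k - gamma * h| <= eta * h) ->
  (forall k, (k <= n)%N -> `|B (clock h r k) - B (k%:R * h)| <= omega) ->
  (forall k, (k < n)%N -> `|X (k%:R * h)| <= K) ->
  (forall k s, (k < n)%N -> k%:R * h <= s <= k.+1%:R * h ->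
     `|X s - X (k%:R * h)| <= omega) ->
  forall k, (k <= n)%N ->
  `|X (k%:R * h) -
    ar_chain r (X 0) (fun i => B (clock h r i.+1) - B (clock h r i)) k| <=
  omega + k%:R * h * ((gamma + eta) * omega + eta * K + gamma * omega).
Proof.
move=> cX g0 h0 eta0 om0 K0 XE r01 rg Bo XK Xo k kn.
set c := (gamma + eta) * omega + eta * K + gamma * omega.
pose Y := ar_chain r (X 0) (fun i => B (clock h r i.+1) - B (clock h r i)).
(* the two processes with their noises removed *)
pose E k := (Y k - B (clock h r k)) - (X (k%:R * h) - B (k%:R * h)).
suff Ek : `|E k| <= k%:R * h * c.
  rewrite -/(Y k) (_ : X (k%:R * h) - Y k =
    - (B (clock h r k) - B (k%:R * h)) - E k); last by rewrite /E; ring.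
  by rewrite (le_trans (ler_normB _ _))// lerD// normrN Bo.
elim: k kn => [|k IH] kn.
  rewrite /E /Y/= /clock big_ord0 mulr0 !mul0r.
  by rewrite (_ : _ - _ = 0) ?normr0//; ring.
have {}IH := IH (ltnW kn).
have kh0 : 0 <= k%:R * h by rewrite mulr_ge0// ltW.
have kkh : k%:R * h <= k.+1%:R * h by rewrite ler_pM2r// ler_nat.
have D := Rintegral_increment cX kh0 kkh.
have kS : k.+1%:R * h - k%:R * h = h by rewrite -natr1; ring.
have N := Rintegral_near_cst cX kkh (Xo k ^~ kn).
rewrite kS -D in N.
have X1 := XE _ (le_trans kh0 kkh); have X0 := XE _ kh0.
set I1 := (\int[mu]_(s in `[0%R, k.+1%:R * h]) X s)%R in N X1.
set I0 := (\int[mu]_(s in `[0%R, k%:R * h]) X s)%R in N X0.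
have /andP[rk0 rk1] := r01 k.
have EE : E k.+1 = r k * E k - (1 - r k) * (B (clock h r k) - B (k%:R * h)) -
    (1 - r k - gamma * h) * X (k%:R * h) +
    gamma * (I1 - I0 - h * X (k%:R * h)).
  have -> : E k.+1 = r k * Y k + (B (clock h r k.+1) - B (clock h r k)) -
    B (clock h r k.+1) - (X (k.+1%:R * h) - B (k.+1%:R * h)) by [].
  have -> : X (k.+1%:R * h) = X (k%:R * h) + (B (k.+1%:R * h) - B (k%:R * h)) -
      gamma * (I1 - I0) by rewrite X1 X0; ring.
  by rewrite /E; ring.
have rgk := rg k kn.
have rh : 1 - r k <= (gamma + eta) * h.
  by move: rgk; rewrite ler_norml => /andP[_]; lra.
rewrite EE (le_trans (ler_normD _ _))//.
rewrite (_ : k.+1%:R * h * c = (k%:R * h * c + (gamma + eta) * h * omega +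
   eta * h * K) + gamma * (h * omega)); last by rewrite -natr1 /c; ring.
rewrite lerD//; last by rewrite normrM gtr0_norm// ler_pM2l.
rewrite (le_trans (ler_normB _ _))// lerD//; last first.
  by rewrite normrM ler_pM// XK.
rewrite (le_trans (ler_normB _ _))// lerD//.
  rewrite normrM ger0_norm// (le_trans _ IH)// ler_piMl//.
rewrite normrM ger0_norm ?subr_ge0// ler_pM ?subr_ge0// Bo// ltnW//.
Qed.

End ou_scheme.

Section scheme_convergence.
Context (R : realType).

(** The ratio [r k] of the chain when its coefficients come from [riccati]. *)
Definition riccati_ratio (e : R) (N k : nat) : R :=
  (1 + riccati e (N - k.+1))^-1.

Lemma riccati_ratio01 e N k : 0 < riccati_ratio e N k <= 1.
Proof.
have a0 := riccati_ge0 e (N - k.+1).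
have a1 : 0 < 1 + riccati e (N - k.+1) by rewrite ltr_pwDl.
by rewrite invr_gt0 a1/= invf_le1// lerDl.
Qed.

Definition ou_chain (h e x : R) (N : nat) (B : R -> R) : nat -> R :=
  let tau := clock h (riccati_ratio e N) in
  ar_chain (riccati_ratio e N) x (fun i => B (tau i.+1) - B (tau i)).

Lemma riccati_ratio_rate (gamma h eta S : R) (N k : nat) :
  0 < gamma -> 0 < h -> 0 < eta -> gamma * h <= 1 ->
  17 * gamma ^+ 2 * h <= eta / 2 -> S + 4 / eta <= N%:R * h ->
  k.+1%:R * h <= S ->
  `|1 - riccati_ratio (gamma * h) N k - gamma * h| <= eta * h.
Proof.
move=> g0 h0 eta0 gh1 hsmall Nlarge kS.
have e0 : 0 < gamma * h by rewrite mulr_gt0.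
have kN : (k < N)%N.
  have : k.+1%:R * h <= N%:R * h.
    by rewrite (le_trans kS)// (le_trans _ Nlarge)// lerDl divr_ge0// ltW.
  by rewrite ler_pM2r// ler_nat.
have := riccati_rate (N - k.+1) e0 gh1; rewrite -/(riccati_ratio _ _ _).
move=> /le_trans; apply.
have Jh : 4 / eta <= (N - k.+1)%:R * h.
  by rewrite natrB// mulrBl; lra.
set J := (N - k.+1)%:R in Jh *.
have Jeta : 4 <= J * h * eta by rewrite -ler_pdivrMr.
have D : 0 < 1 + J * (gamma * h) by rewrite ltr_pwDl// mulr_ge0// ltW.
have E : gamma * (2 / (1 + J * (gamma * h))) <= eta / 2.
  rewrite [leLHS]mulrA ler_pdivrMr// [leRHS]mulrDr mulr1.
  rewrite ler_wpDl ?divr_ge0 ?(ltW eta0)//.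
  rewrite (_ : eta / 2 * _ = gamma * (J * h * eta / 2)); last by ring.
  by rewrite ler_pM2l//; lra.
rewrite (_ : _ * (_ + _) = h * (17 * gamma ^+ 2 * h +
  gamma * (2 / (1 + J * (gamma * h))))); last by ring.
by rewrite [leRHS]mulrC ler_pM2l// [leRHS]splitr lerD.
Qed.

Lemma clock_near (h eta gamma : R) (r : nat -> R) k : 0 <= h ->
  (forall i, (i < k)%N -> `|1 - r i - gamma * h| <= eta * h) ->
  k%:R * h - clock h r k <= k%:R * h * ((gamma + eta) * h).
Proof.
move=> h0; elim: k => [|k IH] rg.
  by rewrite /clock big_ord0 mulr0 !mul0r subr0.
have {}IH := IH (fun i ik => rg i (ltnW ik)).
have := rg k (ltnSn k); rewrite ler_norml => /andP[_ rk].
rewrite /clock big_ord_recr/= mulrDr.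
have -> : k.+1%:R * h - (h * (\sum_(i < k) r i) + h * r k) =
  (k%:R * h - clock h r k) + h * (1 - r k) by rewrite /clock -natr1; ring.
have -> : k.+1%:R * h * ((gamma + eta) * h) =
  k%:R * h * ((gamma + eta) * h) + h * ((gamma + eta) * h).
  by rewrite -natr1; ring.
by rewrite lerD// ler_wpM2l//; lra.
Qed.

Lemma clock_itv (h : R) (r : nat -> R) k : 0 <= h ->
  (forall i, 0 <= r i <= 1) -> 0 <= clock h r k <= k%:R * h.
Proof.
move=> h0 r01; elim: k => [|k /andP[IH0 IH]].
  by rewrite /clock big_ord0 mulr0 mul0r lexx.
have /andP[r0 r1] := r01 k.
have E : clock h r k.+1 = clock h r k + h * r k.
  by rewrite /clock big_ord_recr/= mulrDr.
have -> : k.+1%:R * h = k%:R * h + h by rewrite -natr1 mulrDl mul1r.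
rewrite E; apply/andP; split; first by rewrite addr_ge0// mulr_ge0.
by rewrite lerD// ler_piMr.
Qed.

(** On a bounded set of times, the distance to the horizon tends to infinity,
    the ratios satisfy [1 - r = gamma h + o(h)] uniformly, and the clock lags
    behind [k * h] by [O(h)]; [ou_scheme_error] then applies with errors that
    vanish because [X] and [B] are uniformly continuous on segments. *)
Lemma ou_scheme_cvg (X B : pathspace R) (gamma : R) (h : nat -> R)
    (N M : nat -> nat) : 0 < gamma ->
  (forall t, 0 <= t -> eval_at X t = eval_at X 0 + eval_at B t -
     gamma * (\int[lebesgue_measure]_(s in `[0%R, t]) eval_at X s)%R) ->
  (forall n, 0 < h n) -> h n @[n --> \oo] --> (0 : R) ->
  (N n)%:R * h n @[n --> \oo] --> +oo ->
  (M n)%:R * h n @[n --> \oo] --> +oo ->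
  interp_path (h n) (M n)
    (ou_chain (h n) (gamma * h n) (eval_at X 0) (N n) (eval_at B))
    @[n --> \oo] --> X.
Proof.
move=> g0 XE h0 hcvg Nh Mh; apply: interp_path_cvg => // S0 e e0.
have [S S1 S0S] : exists2 S, 0 < S & S0 <= S.
  exists (Num.max 0 S0 + 1); first by rewrite ltr_wpDl// le_max lexx.
  by rewrite ler_wpDr// le_max lexx orbT.
have [K K0 XK] := bounded_on_segment S (@continuous_eval_at _ X).
have e20 : 0 < e / 2 by rewrite divr_gt0.
(* omega and eta split the bound of ou_scheme_error on [0, S] into halves:
   one is a multiple of omega, the other a multiple of eta *)
pose omega := (e / 2) / (1 + S * (2 * gamma + 1)).
have dom : 0 < 1 + S * (2 * gamma + 1).
  by rewrite ltr_pwDl// mulr_ge0 ?addr_ge0 ?mulr_ge0// ?(ltW S1) ?(ltW g0).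
have om0 : 0 < omega by rewrite divr_gt0.
pose eta := Num.min 1 ((e / 2) / (1 + S * K)).
have dK : 0 < 1 + S * K by rewrite ltr_pwDl// mulr_ge0// ltW.
have eta0 : 0 < eta by rewrite lt_min ltr01 divr_gt0.
have eta1 : eta <= 1 by rewrite ge_min lexx.
have etaK : eta * (1 + S * K) <= e / 2.
  by rewrite -ler_pdivlMr// ge_min lexx orbT.
have omE : omega * (1 + S * (2 * gamma + 1)) = e / 2.
  by rewrite /omega divfK// gt_eqF.
have [dX dX0 Xd] := heine S (@continuous_eval_at _ X) om0.
have [dB dB0 Bd] := heine S (@continuous_eval_at _ B) om0.
have hsm (c : R) : 0 < c -> \forall n \near \oo, h n <= c.
  move=> c0; have /cvgrPdist_le/(_ _ c0) := hcvg.
  by apply: filterS => n; rewrite sub0r normrN gtr0_norm.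
near=> n => k kS0.
have kS : k%:R * h n <= S.
  exact: le_trans S0S.
have hg1 : h n <= gamma^-1 by near: n; apply: hsm; rewrite invr_gt0.
have he1 : h n <= (eta / 2) / (17 * gamma ^+ 2).
  by near: n; apply: hsm; rewrite !divr_gt0// mulr_gt0// exprn_gt0.
have hX : h n <= dX by near: n; exact: hsm.
have hB : h n <= dB / (S * (gamma + 1)).
  by near: n; apply: hsm; rewrite divr_gt0// mulr_gt0// addr_gt0.
have Nlarge : S + 4 / eta <= (N n)%:R * h n.
  by near: n; move/cvgryPge : Nh => /(_ (S + 4 / eta)).
have hn0 := h0 n.
have rate i : (i < k)%N ->
    `|1 - riccati_ratio (gamma * h n) (N n) i - gamma * h n| <= eta * h n.
  move=> ik; apply: (riccati_ratio_rate (S := S)) => //.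
  - by rewrite mulrC -ler_pdivlMr// div1r.
  - by rewrite mulrC -ler_pdivlMr// mulr_gt0// exprn_gt0.
  - by rewrite (le_trans _ kS)// ler_pM2r// ler_nat.
have r01 i : 0 <= riccati_ratio (gamma * h n) (N n) i <= 1.
  by have /andP[r0 r1] := riccati_ratio01 (gamma * h n) (N n) i; rewrite ltW.
have iS i : (i <= k)%N -> 0 <= i%:R * h n <= S.
  move=> ik; rewrite mulr_ge0 ?(ltW hn0)//= (le_trans _ kS)// ler_pM2r//.
  by rewrite ler_nat.
have Bclock i : (i <= k)%N -> `|eval_at B (clock (h n)
    (riccati_ratio (gamma * h n) (N n)) i) - eval_at B (i%:R * h n)| <= omega.
  move=> ik.
  have /andP[c0 c1] := clock_itv i (ltW hn0) r01.
  have /andP[i0 i1] := iS i ik.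
  apply: Bd; [by rewrite c0 (le_trans c1)|by rewrite i0|].
  rewrite ler0_norm ?subr_le0// opprB.
  have := clock_near (ltW hn0) (fun j ji => rate j (leq_trans ji ik)).
  move=> /le_trans; apply.
  move: hB; rewrite ler_pdivlMr ?mulr_gt0 ?addr_gt0//; apply: le_trans.
  rewrite [leRHS]mulrC -[leRHS]mulrA ler_pM//.
    by rewrite mulr_ge0 ?addr_ge0 ?ltW.
  by rewrite ler_wpM2r ?(ltW hn0)// lerD2l.
have XKi i : (i < k)%N -> `|eval_at X (i%:R * h n)| <= K.
  by move=> ik; apply: XK; apply: iS; exact: ltnW.
have Xmod i s : (i < k)%N -> i%:R * h n <= s <= i.+1%:R * h n ->
   `|eval_at X s - eval_at X (i%:R * h n)| <= omega.
  move=> ik /andP[is1 is2].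
  have /andP[i0 i1] := iS i (ltnW ik); have /andP[j0 j1] := iS i.+1 ik.
  apply: Xd.
  - by rewrite (le_trans i0 is1) (le_trans is2 j1).
  - by rewrite i0.
  - rewrite ger0_norm ?subr_ge0// (le_trans _ hX)// lerBlDr (le_trans is2)//.
    by rewrite -natr1 mulrDl mul1r addrC.
have := @ou_scheme_error R (eval_at X) (eval_at B) gamma (h n) eta omega K
  (riccati_ratio (gamma * h n) (N n)) k (@continuous_eval_at _ X) g0 hn0
  (ltW eta0) (ltW om0) K0 XE r01 rate Bclock XKi Xmod k (leqnn k).
move=> /le_trans; apply.
have /andP[k0 _] := iS k (leqnn k).
have D0 : 0 <= (gamma + eta) * omega + eta * K + gamma * omega.
  have [g1 o1 t1] : [/\ 0 <= gamma, 0 <= omega & 0 <= eta] by rewrite !ltW.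
  by rewrite !addr_ge0// mulr_ge0// addr_ge0.
apply: (@le_trans _ _ (omega +
    S * ((gamma + eta) * omega + eta * K + gamma * omega))).
  by rewrite lerD2l; exact: ler_wpM2r.
apply: (@le_trans _ _ (omega * (1 + S * (2 * gamma + 1)) + eta * (1 + S * K))).
  rewrite -subr_ge0 (_ : _ - _ = S * omega * (1 - eta) + eta); last by ring.
  rewrite addr_ge0 ?(ltW eta0)// mulr_ge0 ?subr_ge0//.
  by rewrite mulr_ge0 ?(ltW om0) ?(ltW S1).
by rewrite omE [leRHS]splitr lerD2l.
Unshelve. all: by end_near. Qed.

End scheme_convergence.

(** * Measurability of functionals of finitely many values *)

Section tuple_measurability.
Context (R : realType).

(** The preimage of any set is a countable union of fibers. *)
Lemma measurable_countable_fibers d (T : measurableType d)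
    (U : countType) (phi : T -> U) (g : U -> R) :
  (forall u, measurable (phi @^-1` [set u])) ->
  measurable_fun [set: T] (g \o phi).
Proof.
move=> mphi _ Y mY; rewrite setTI.
rewrite (_ : _ @^-1` Y = \bigcup_(u in [set: U])
    (if `[<Y (g u)>] then phi @^-1` [set u] else set0)).
  by apply: countable_bigcupT_measurable => // u; case: ifP.
apply/seteqP; split => [t /= Yt|t [u _ /=]].
  by exists (phi t) => //; rewrite asboolT.
by case: asboolP => // Yu ->.
Qed.

Definition round_down (m : nat) (a : R) : R :=
  (Num.floor (m.+1%:R * a))%:~R / m.+1%:R.

Lemma round_down_near m a : `|a - round_down m a| <= m.+1%:R^-1.
Proof.
have m0 : 0 < m.+1%:R :> R by [].
have /andP[f1 f2] := floor_itv (m.+1%:R * a).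
rewrite (_ : a - round_down m a =
    (m.+1%:R * a - (Num.floor (m.+1%:R * a))%:~R) / m.+1%:R); last first.
  by rewrite mulrBl mulrAC divff ?gt_eqF// mul1r.
rewrite ger0_norm ?divr_ge0 ?subr_ge0//.
rewrite -[leRHS]mul1r ler_pM2r ?invr_gt0// lerBlDr addrC.
by move: f2; rewrite intrD => /ltW.
Qed.

Lemma round_down_cvg a : round_down m a @[m --> \oo] --> a.
Proof.
apply/cvgrPdist_le => _/posnumP[e]; near=> m.
rewrite (le_trans (round_down_near _ _))// ltW//.
by near: m; exact: near_infty_natSinv_lt.
Unshelve. all: by end_near. Qed.

(** [F] is the pointwise limit of its values at rounded coordinates, and these
    are functions with countably many values and measurable fibers. *)
Lemma measurable_sequentially_continuous n (F : n.-tuple R -> R) :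
  (forall (t : n.-tuple R) (u : nat -> n.-tuple R),
     (forall i, nth 0 (u m) i @[m --> \oo] --> nth 0 t i) ->
     F (u m) @[m --> \oo] --> F t) ->
  measurable_fun [set: n.-tuple R] F.
Proof.
move=> cF.
(* rounding factors through the countable type of tuples of integers *)
pose fl m (t : n.-tuple R) : n.-tuple int :=
  map_tuple (fun a => Num.floor (m.+1%:R * a)) t.
pose unfl m (z : n.-tuple int) : n.-tuple R :=
  map_tuple (fun k : int => k%:~R / m.+1%:R) z.
apply: (@measurable_fun_cvg _ _ _ _ (fun m => (F \o unfl m) \o fl m)).
  move=> m; apply: measurable_countable_fibers => z.
  rewrite (_ : _ @^-1` _ = \bigcap_(i in [set: 'I_n])
    ((fun t : n.-tuple R => m.+1%:R * tnth t i) @^-1`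
      `[(tnth z i)%:~R, (tnth z i + 1)%:~R[)).
    apply: fin_bigcap_measurable => // i _.
    rewrite -[X in measurable X]setTI.
    have mi : measurable_fun [set: n.-tuple R]
      (fun t : n.-tuple R => m.+1%:R * tnth t i).
      by apply: measurable_funM => //; exact: measurable_tnth.
    exact: mi.
  apply/seteqP; split => [t /= <- i _|t /= tz].
    by rewrite /= in_itv/= tnth_map floor_itv.
  apply: eq_from_tnth => i; rewrite tnth_map; apply: floor_def.
  by have := tz i Logic.I; rewrite /= in_itv.
move=> t _; apply: cF => i.
have [i_n|n_i] := ltnP i n; last first.
  rewrite nth_default ?size_tuple//.
  under eq_fun do rewrite nth_default ?size_tuple//.
  exact: cvg_cst.
under eq_fun do rewrite /= -map_comp (nth_map 0) ?size_tuple//.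
exact: round_down_cvg.
Qed.

Lemma dist_interp (h : R) M y y' t (e : R) :
  (forall k, (k <= M)%N -> `|y k - y' k| <= e) ->
  `|interp h M y t - interp h M y' t| <= (1 + 2 * M%:R) * e.
Proof.
move=> yy'; rewrite /interp.
rewrite (_ : _ - _ = (y 0%N - y' 0%N) +
    \sum_(k < M) ((y k.+1 - y' k.+1) - (y k - y' k)) * clamp (t / h - k%:R)).
  rewrite (le_trans (ler_normD _ _))// mulrDl mul1r lerD ?yy'//.
  rewrite (le_trans (ler_norm_sum _ _ _))//.
  rewrite (_ : _ * e = \sum_(k < M) (2 * e)); last first.
    by rewrite sumr_const card_ord -[RHS]mulr_natr; ring.
  apply: ler_sum => k _; rewrite normrM -[leRHS]mulr1 ler_pM//.
    rewrite (le_trans (ler_normB _ _))// (_ : 2 * e = e + e); last by ring.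
    by rewrite lerD// yy'// ltnW.
  have c0 : 0 <= clamp (t / h - k%:R) by rewrite le_min ler01 le_max lexx.
  by rewrite ger0_norm// ge_min lexx.
rewrite opprD addrACA -sumrB; congr (_ + _).
by apply: eq_bigr => k _; ring.
Qed.

(** The entries are read from the last one since paths of chains are stored with
    their latest value first. *)
Lemma measurable_interp_functional (h : R) M n (f : pathspace R -> R) :
  continuous f ->
  measurable_fun [set: n.-tuple R]
    (fun t : n.-tuple R => f (interp_path h M (fun k => nth 0 t (n.-1 - k)))).
Proof.
move=> cf; apply: measurable_sequentially_continuous => t u ut.
apply: (@cvg_comp _ _ _
  (fun m => interp_path h M (fun k => nth 0 (u m) (n.-1 - k)))
  f _ (nbhs (interp_path h M (fun k => nth 0 t (n.-1 - k))))); last exact: cf.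
apply: pathspace_cvg => S e e0.
have M0 : 0 < 1 + 2 * M%:R :> R by rewrite ltr_pwDl// mulr_ge0.
have eM : 0 < e / (1 + 2 * M%:R) by rewrite divr_gt0.
have : \forall m \near \oo, forall k : 'I_M.+1,
    `|nth 0 t (n.-1 - k) - nth 0 (u m) (n.-1 - k)| <= e / (1 + 2 * M%:R).
  apply: filter_forall => k.
  by have /cvgrPdist_le/(_ _ eM) := ut (n.-1 - k)%N.
apply: filterS => m um s /andP[s0 _].
rewrite !eval_at_interp_path//.
rewrite (le_trans (@dist_interp h M _ _ s (e / (1 + 2 * M%:R)) _))//.
  by move=> k kM; exact: (um (Ordinal (kM : (k < M.+1)%N))).
by rewrite mulrC divfK// gt_eqF.
Qed.

End tuple_measurability.

(** * The law conditioned on survival *)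

Section exponential_tail.
Context (R : realType).

(** The antiderivative of the density is [- exp (- rate x)]. *)
Lemma exponential_prob_itvcy (rate c : R) : 0 < rate -> 0 <= c ->
  exponential_prob rate `[c, +oo[ = (expR (- (rate * c)))%:E.
Proof.
move=> rate0 c0.
have cexp : continuous (fun z : R => expR (- rate * z)).
  move=> z; apply: continuous_comp; last exact: continuous_expR.
  apply: continuousM => //; apply: (@continuousN _ R^o).
  exact: cst_continuous.
rewrite /exponential_prob (@ge0_continuous_FTC2y _ _
  (fun x => - expR (- rate * x)) _ 0).
- by rewrite EFinN oppeK add0e mulNr.
- by move=> x _; apply: exponential_pdf_ge0; exact: ltW.
- apply: (@continuous_subspaceW R^o _ _ [set` `[0, +oo[%R]).
    by apply: subset_itvr; rewrite bnd_simp.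
  exact: within_continuous_exponential_pdf.
- rewrite -oppr0; apply: cvgN.
  rewrite (_ : (fun x => expR (- rate * x)) =
               (fun z => expR (- z)) \o (fun z => rate * z)); last first.
    by apply: eq_fun => x; rewrite mulNr.
  apply: (@cvg_comp _ _ _ _ _ _ (pinfty_nbhs R)); last exact: cvgr_expR.
  exact: gt0_cvgMry.
- by move=> z _; exact: ex_derive.
- by apply: cvgN; apply/cvg_at_right_filter; exact: cexp.
- move=> z; rewrite in_itv/= andbT => cz; apply: derive1_exponential_pdf.
  by rewrite in_itv/= andbT (le_lt_trans c0).
Qed.

End exponential_tail.

Section conditioning.
Local Open Scope ereal_scope.
Context d (Omega : measurableType d) (R : realType) (P : probability Omega R).

(** The conditional probability has density [1_E / P E] with respect to [P]. *)
Lemma ge0_integral_conditional_prob (E : set Omega) (mE : measurable E)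
    (f : Omega -> \bar R) : 0 < P E ->
  measurable_fun [set: Omega] f -> (forall w, 0 <= f w) ->
  \int[conditional_prob P mE]_w f w =
  (fine (P E))^-1%:E * \int[P]_w (f w * (\1_E w)%:E).
Proof.
move=> PE mf f0.
have PEfin : P E \is a fin_num by exact: fin_num_measure.
have fPE : (0 < fine (P E))%R by rewrite fine_gt0// PE -ge0_fin_numE.
pose c : R := ((fine (P E))^-1)%R.
have c0 : (0 <= c)%R by rewrite invr_ge0 ltW.
have mI : measurable_fun [set: Omega] (fun w => \1_E w : R).
  exact: measurable_indic.
rewrite (@ge0_integral_density _ _ _ P _ (fun w => c * \1_E w)%R)//.
- rewrite -ge0_integralZl//; last 2 first.
  + by apply: emeasurable_funM => //; exact/measurable_EFinP.
  + by move=> w _; rewrite mule_ge0// lee_fin.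
  by apply: eq_integral => w _; rewrite EFinM muleCA.
- exact: measurable_funM.
- by move=> w; rewrite mulr_ge0.
- move=> A mA.
  rewrite /= /conditional_prob/= /mnormalize/=.
  have PEy : (P E == +oo) = false.
    by apply/negbTE; rewrite -ltey -ge0_fin_numE.
  rewrite /mrestr setTI gt_eqF//= PEy.
  under eq_integral do rewrite EFinM.
  rewrite ge0_integralZl//; last first.
  + by apply: measurable_funTS; exact/measurable_EFinP.
  rewrite integral_indic// muleC; congr (_ * P _).
  by rewrite setIC.
Qed.

End conditioning.

Section penalized_law_integral.
Local Open Scope ereal_scope.
Context d (Omega : measurableType d) (R : realType) (P : probability Omega R).
Variables (W : {RV P >-> pathspace R}) (eta : {RV P >-> R}) (gamma : R).
Hypothesis gamma_gt0 : (0 < gamma)%R.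
Hypothesis eta_exp : exponential_RV (2 / gamma ^+ 2) eta.
Hypothesis W_eta_indep : independent_pair P W eta.

(** The conditional probability of [I_T <= eta] given the path [w]. *)
Definition survival T (w : pathspace R) : R :=
  expR (- (gamma ^+ 2 * sq_integral T w) / 2).

Lemma sq_integral_ge0 T (w : pathspace R) : (0 <= sq_integral T w)%R.
Proof. by apply: Rintegral_ge0 => s _; exact: sqr_ge0. Qed.

Lemma measurable_sq_integral T :
  measurable_fun [set: pathspace R] (@sq_integral R T).
Proof.
exact: continuous_pathspace_measurable (@continuous_sq_integral R T).
Qed.

Lemma measurable_survival T : measurable_fun [set: pathspace R] (survival T).
Proof.
apply: measurableT_comp => //; apply: measurable_funM => //.
apply: measurableT_comp => //; apply: measurable_funM => //.
exact: measurable_sq_integral.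
Qed.

(** Fubini, integrating first in [eta] with the path fixed. *)
Lemma ge0_integral_survive T (F : pathspace R -> \bar R) :
  measurable_fun [set: pathspace R] F -> (forall w, 0 <= F w) ->
  \int[P]_omega (F (W omega) *
    (\1_[set o | (sq_integral T (W o) <= eta o)%R] omega)%:E) =
  \int[P]_omega (F (W omega) * (survival T (W omega))%:E).
Proof.
move=> mF F0.
pose E2 : set (pathspace R * R) := [set z | (sq_integral T z.1 <= z.2)%R].
have mE2 : measurable E2.
  rewrite -[X in measurable X]setTI; apply: measurable_fun_le => //.
  by apply: measurableT_comp => //; exact: measurable_sq_integral.
pose g (z : pathspace R * R) := F z.1 * (\1_E2 z)%:E.
have mg : measurable_fun [set: pathspace R * R] g.
  apply: emeasurable_funM; first exact: measurableT_comp.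
  by apply/measurable_EFinP; exact: measurable_indic.
have g0 z : 0 <= g z by rewrite mule_ge0// lee_fin.
transitivity (\int[P]_w g (W w, eta w)).
  by apply: eq_integral => w _; rewrite /g/=; congr (_ * _%:E).
rewrite (ge0_expectation_indep (nu := distribution P eta)
  _ _ W_eta_indep _ mg g0)//.
apply: eq_integral => w _.
rewrite /g/= ge0_integralZl//; last first.
- apply/measurable_EFinP.
  apply: (@measurableT_comp _ _ _ _ _ _ (fun z => \1_E2 z : R)
    _ (fun y => (W w, y))); first exact: measurable_indic.
  exact: measurable_pair1.
congr (_ * _).
rewrite (_ : (fun y => (\1_E2 (W w, y))%:E) =
  (fun y => (\1_(`[sq_integral T (W w), +oo[%classic) y)%:E)); last first.
  apply/funext => y; rewrite !indicE; congr (_%:R%:E).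
  congr nat_of_bool; apply/idP/idP; rewrite !inE/= in_itv/= andbT//.
rewrite integral_indic// setIT.
apply: etrans (eta_exp (measurable_itv _)) _; rewrite exponential_prob_itvcy.
- by rewrite /survival; congr (expR _)%:E; field; rewrite gt_eqF.
- by rewrite invr_gt0 divr_gt0// exprn_gt0.
- exact: sq_integral_ge0.
Qed.

Lemma survival_gt0 T w : (0 < survival T w)%R. Proof. exact: expR_gt0. Qed.

Lemma survival_le1 T w : (survival T w <= 1)%R.
Proof.
rewrite -expR0 ler_expR mulNr oppr_le0 divr_ge0// mulr_ge0 ?sqr_ge0//.
exact: sq_integral_ge0.
Qed.

Lemma prob_survive T :
  P [set o | (sq_integral T (W o) <= eta o)%R] =
  \int[P]_omega (survival T (W omega))%:E.
Proof.
have := @ge0_integral_survive T (cst 1) (measurable_cst _) (fun=> lee01).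
under eq_integral do rewrite mul1e.
under [in RHS]eq_integral do rewrite mul1e.
move=> <-; rewrite integral_indic ?setIT//.
exact: measurable_sq_integral_le.
Qed.

(** The integrand is positive everywhere, so its integral cannot vanish. *)
Lemma prob_survive_gt0 T : 0 < P [set o | (sq_integral T (W o) <= eta o)%R].
Proof.
rewrite prob_survive lt_neqAle eq_sym.
rewrite integral_ge0 ?andbT; last first.
  by move=> w _; rewrite lee_fin ltW// survival_gt0.
apply/negP => /eqP H.
have mS : measurable_fun [set: Omega] (fun o => (survival T (W o))%:E).
  apply/measurable_EFinP; apply: measurableT_comp => //.
  exact: measurable_survival.
have /(ae_eq_integral_abs P measurableT mS)[N [mN N0 SN]] :
    \int[P]_o `|(survival T (W o))%:E| = 0.
  rewrite -[RHS]H; apply: eq_integral => o _.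
  by rewrite gee0_abs// lee_fin ltW// survival_gt0.
have : P setT <= P N.
  apply: le_measure; rewrite ?inE//= => o _; apply: SN => /= /(_ Logic.I)/eqP.
  by rewrite eqe gt_eqF// survival_gt0.
by rewrite N0 probability_setT lee_fin ler10.
Qed.

Lemma ge0_integral_penalized_law T (F : pathspace R -> \bar R) :
  measurable_fun [set: pathspace R] F -> (forall w, 0 <= F w) ->
  \int[penalized_law W eta T]_w F w =
  (fine (\int[P]_omega (survival T (W omega))%:E))^-1%:E *
  \int[P]_omega (F (W omega) * (survival T (W omega))%:E).
Proof.
move=> mF F0.
rewrite /penalized_law ge0_integral_distribution//.
rewrite ge0_integral_conditional_prob; last 3 first.
- exact: prob_survive_gt0.
- exact: measurableT_comp.
- by move=> w; exact: F0.
by rewrite /= ge0_integral_survive// prob_survive.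
Qed.

End penalized_law_integral.

(** * Discrete Girsanov identity *)

Section bounded_convergence.
Context d (Omega : measurableType d) (R : realType) (P : probability Omega R).

Lemma bounded_integrable (f : Omega -> R) (K : R) :
  measurable_fun [set: Omega] f -> (forall w, `|f w| <= K) ->
  P.-integrable [set: Omega] (EFin \o f).
Proof.
move=> mf fK; apply: (@le_integrable _ _ _ P setT measurableT _ (cst K%:E)).
- exact/measurable_EFinP.
- move=> w _ /=; rewrite lee_fin (le_trans (fK w))// ler_norm//.
- exact: finite_measure_integrable_cst.
Qed.

Lemma bounded_Rintegral_cvg (f_ : nat -> Omega -> R) (f : Omega -> R) (K : R) :
  (forall n, measurable_fun [set: Omega] (f_ n)) ->
  measurable_fun [set: Omega] f -> (forall n w, `|f_ n w| <= K) ->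
  {ae P, forall w, f_ n w @[n --> \oo] --> f w} ->
  (\int[P]_w f_ n w)%R @[n --> \oo] --> (\int[P]_w f w)%R.
Proof.
move=> mf_ mf fK cvg_f.
have [] := @dominated_convergence _ _ _ P setT measurableT
  (fun n => EFin \o f_ n) (EFin \o f) (cst K%:E).
- by move=> n; exact/measurable_EFinP.
- exact/measurable_EFinP.
- by apply: filterS cvg_f => w wcvg _; apply/fine_cvgP; split; [exact: nearW|].
- exact: finite_measure_integrable_cst.
- by apply: nearW => w n _ /=; rewrite lee_fin.
move=> intf _.
rewrite -[X in _ --> X]fineK; last exact: integrable_fin_num.
by move=> /fine_cvgP[_].
Qed.

End bounded_convergence.

Section evaluation.
Context (R : realType).

Lemma continuous_evaluation (t : R) :
  continuous (fun w : pathspace R => eval_at w t).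
Proof.
move=> w; apply/(@cvgrPdist_lt _ _ _ (nbhs w) (nbhs_filter w)) => e e0.
have cK : compact [set clip t] by exact: compact_set1.
have wK : nbhs (w : {family compact, halfline R -> R})
    [set h : halfline R -> R | forall y, [set clip t] y -> `|w y - h y| < e].
  have /fam_cvgP/(_ _ cK) : {family compact,
    nbhs (w : {family compact, halfline R -> R}) --> (w : halfline R -> R)}.
    exact: (@cvg_id _ (nbhs (w : {family compact, halfline R -> R}))).
  apply; apply/uniform_nbhs; exists [set xy | ball xy.1 e xy.2].
  by split => //; exact: (entourage_ball R^o (PosNum e0)).
have : nbhs (w : pathspace R)
    [set v : pathspace R | forall y, [set clip t] y -> `|w y - v y| < e].
  exact: (@initial_continuous (continuousType (halfline R) R)
    {family compact, halfline R -> R} id w _ wK).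
by apply: filterS => v; apply.
Qed.

Lemma measurable_evaluation (t : R) :
  measurable_fun [set: pathspace R] (fun w => eval_at w t).
Proof. exact: continuous_pathspace_measurable (@continuous_evaluation t). Qed.

Lemma eq_interp_path (h : R) M y y' : (forall k, (k <= M)%N -> y k = y' k) ->
  interp_path h M y = interp_path h M y'.
Proof.
move=> yy'; apply/continuousEP => u.
rewrite /interp_path/= /mkcts /interp yy'//.
by congr (_ + _); apply: eq_bigr => k _;
  rewrite (yy' _ (ltn_ord k)) (yy' _ (ltnW (ltn_ord k))).
Qed.

End evaluation.

Section brownian_increments.
Context (R : realType) d (Omega : measurableType d) (P : probability Omega R).
Variables (x : R) (W : {RV P >-> pathspace R}) (W_bm : brownian_motion x W).
Variable (t : nat -> R).
Hypotheses (t0 : 0 <= t 0%N) (t_incr : forall n, t n < t n.+1).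

Definition increment n omega : R :=
  eval_at (W omega) (t n.+1) - eval_at (W omega) (t n).

Let t_homo : {homo t : i j / (i <= j)%N >-> i <= j}.
Proof.
move=> i j /subnK <-; elim: (j - i)%N => // k IH.
by rewrite addSn (le_trans IH)// ltW.
Qed.

Lemma measurable_increment n : measurable_fun [set: Omega] (increment n).
Proof.
have mW s : measurable_fun [set: Omega] (fun omega => eval_at (W omega) s).
  by apply: (measurableT_comp (@measurable_evaluation R s)).
exact: measurable_funB.
Qed.

Lemma independent_increments n :
  mutually_independent P (fun i : 'I_n => increment i).
Proof. by case: W_bm => _ _; apply. Qed.

Lemma increment_law n B : measurable B ->
  P (increment n @^-1` B) = normal_prob 0 (Num.sqrt (t n.+1 - t n)) B.
Proof.
case: W_bm => _ law _ mB; apply: law => //.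
by rewrite (le_trans t0)// t_homo.
Qed.

End brownian_increments.

Section discrete_girsanov.
Context (R : realType) (gamma x h : R) (N : nat).
Hypothesis h_gt0 : 0 < h.
Context d (Omega : measurableType d) (P : probability Omega R)
  (W : {RV P >-> pathspace R}).
Hypothesis W_bm : brownian_motion x W.
Context d' (Omega' : measurableType d') (P' : probability Omega' R)
  (b : R) (B : {RV P' >-> pathspace R}).
Hypothesis B_bm : brownian_motion b B.

Notation e := (gamma * h).
Notation ratio := (riccati_ratio e N).
Notation grid := (fun k : nat => k%:R * h).
Notation dW := (increment W grid).
Notation dB := (increment B (clock h ratio)).

Definition walk omega : nat -> R :=
  ar_chain (fun=> 1) x (fun i => increment W (fun k => k%:R * h) i omega).

Lemma walkE omega k : walk omega k =
  x + (eval_at (W omega) (k%:R * h) - eval_at (W omega) 0).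
Proof.
rewrite /walk; elim: k => [|k IH] /=; first by rewrite mul0r subrr addr0.
by rewrite IH /increment mul1r; ring.
Qed.

(** [survival] with [I_T] replaced by its left Riemann sum. *)
Definition discrete_survival omega : R :=
  expR (- (gamma ^+ 2 * (h * \sum_(k < N) walk omega k ^+ 2)) / 2).

Let s k := riccati e (N - k) / h.

Let s_ge0 k : 0 <= s k.
Proof. by rewrite divr_ge0 ?riccati_ge0// ltW. Qed.

Let ratioE : (fun k => (1 + h * s k.+1)^-1) = ratio.
Proof.
by apply/funext => k; rewrite /s /riccati_ratio mulrC divfK// gt_eqF.
Qed.

Let energyE n (z : nat -> R) : (N <= n)%N ->
  energy h s (ar_path (fun=> 1) x z n) =
  gamma ^+ 2 * (h * \sum_(k < N) ar_chain (fun=> 1) x z k ^+ 2).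
Proof.
move=> Nn; rewrite /energy.
have sN j : (N <= j)%N -> s j = 0.
  by rewrite -subn_eq0 /s => /eqP ->; rewrite /= mul0r.
rewrite sN// mul0r add0r mulrA mulr_sumr (big_ord_widen n
  (fun k => gamma ^+ 2 * h * ar_chain (fun=> 1) x z k ^+ 2))//.
rewrite [RHS]big_mkcond; apply: eq_bigr => i _.
rewrite nth_ar_path ?(ltnW (ltn_ord i))//.
have [iN|Ni] := ltnP i N.
  rewrite /s -(subnSK iN) /= [X in _ - _ * (1 + X)^-1]mulrC divfK ?gt_eqF//.
  congr (_ * _).
  have a1 : 1 + riccati e (N - i.+1) != 0.
    by rewrite gt_eqF// ltr_pwDl// riccati_ge0.
  by field; rewrite a1 gt_eqF.
by rewrite (sN _ Ni) (sN _ (leqW Ni)) sub0r mul0r oppr0 mul0r.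
Qed.

Let grid0 : 0 <= grid 0%N. Proof. by rewrite mulr_ge0// ltW. Qed.
Let grid_incr k : grid k < grid k.+1.
Proof. by rewrite ltr_pM2r// ltr_nat. Qed.
Let gridB k : grid k.+1 - grid k = h.
Proof. by cbv beta; rewrite -natr1; ring. Qed.
Let clock0 : 0 <= clock h ratio 0%N.
Proof. by rewrite /clock big_ord0 mulr0. Qed.
Let clockB k : clock h ratio k.+1 - clock h ratio k = h * ratio k.
Proof. by rewrite /clock big_ord_recr/=; ring. Qed.
Let clock_incr k : clock h ratio k < clock h ratio k.+1.
Proof.
rewrite -subr_gt0 clockB mulr_gt0//.
by have /andP[] := riccati_ratio01 e N k.
Qed.

(** With the Riccati coefficients, the weight [q k] of [tilted_expectation] is
    [gamma^2 h] before the horizon and [0] from the horizon on, so the energy is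
    the Riemann sum. The constant is common to all functionals, so that it
    disappears from ratios. *)
Lemma discrete_girsanov n : (N <= n)%N ->
  exists2 C : R, 0 < C & forall (f : pathspace R -> R) (K : R),
    continuous f -> (forall w, 0 <= f w <= K) ->
    (\int[P]_omega (f (interp_path h n (walk omega)) *
       discrete_survival omega))%R =
    C * (\int[P']_omega
      f (interp_path h n (ou_chain h e x N (eval_at (B omega)))))%R.
Proof.
move=> Nn; exists (tilt_cst h x s n) => [|f K cf f0K].
  exact: tilt_cst_gt0.
have mF := @measurable_interp_functional R h n n.+1 f cf.
pose path_of (t : n.+1.-tuple R) :=
  interp_path h n (fun k => nth 0 t (n - k)).
pose F (t : n.+1.-tuple R) := (f (path_of t))%:E.
have mEF : measurable_fun [set: n.+1.-tuple R] F by exact/measurable_EFinP.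
have F0 t : (0 <= F t)%E.
  by rewrite lee_fin; have /andP[] := f0K (path_of t).
have lawW k A : measurable A -> P (dW k @^-1` A) = normal_prob 0 (Num.sqrt h) A.
  move=> mA; have := increment_law W_bm grid0 grid_incr k mA.
  rewrite gridB => E; exact: E.
have lawB k A : measurable A -> P' (dB k @^-1` A) =
    normal_prob 0 (Num.sqrt (h * (1 + h * s k.+1)^-1)) A.
  move=> mA; have := increment_law B_bm clock0 clock_incr k mA.
  rewrite clockB -ratioE => E; exact: E.
have := @tilted_expectation R h x s h_gt0 s_ge0 _ Omega P dW
  (measurable_increment W _) (independent_increments W_bm grid0 grid_incr) lawW
  _ Omega' P' dB (measurable_increment B _)
  (independent_increments B_bm clock0 clock_incr) lawB n F mEF F0.
rewrite ratioE => E.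
have FW omega : F (ar_path (fun=> 1) x (dW^~ omega) n) =
    (f (interp_path h n (walk omega)))%:E.
  congr (f _)%:E; apply: eq_interp_path => k kn; exact: nth_ar_path.
have FB omega : F (ar_path ratio x (dB^~ omega) n) =
    (f (interp_path h n (ou_chain h e x N (eval_at (B omega)))))%:E.
  congr (f _)%:E; apply: eq_interp_path => k kn; exact: nth_ar_path.
have DE omega : discrete_survival omega =
    expR (- energy h s (ar_path (fun=> 1) x (dW^~ omega) n) / 2).
  by rewrite (energyE _ Nn).
rewrite /Rintegral (_ : (\int[P]_omega _)%E = (tilt_cst h x s n)%:E *
    \int[P']_w F (ar_path ratio x (dB^~ w) n))%E; last first.
  rewrite -[RHS]E; apply: eq_integral => omega _.
  by rewrite EFinM FW DE.
rewrite fineM//; last first.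
  apply: integrable_fin_num => //.
  apply: (@bounded_integrable _ _ _ P'
    (fun w => f (path_of (ar_path ratio x (dB^~ w) n))) K).
    apply: (measurableT_comp mF); apply: measurable_ar_path => i _.
    exact: measurable_increment.
  move=> w; have /andP[Fw0 FwK] := f0K (path_of (ar_path ratio x (dB^~ w) n)).
  by rewrite ger0_norm.
congr (_ * fine _); apply: eq_integral => w _; exact: FB.
Qed.

Lemma measurable_walk k : measurable_fun [set: Omega] (walk ^~ k).
Proof.
by apply: measurable_ar_chain => i _; exact: measurable_increment.
Qed.

Lemma measurable_discrete_survival :
  measurable_fun [set: Omega] discrete_survival.
Proof.
apply: measurableT_comp => //; apply: measurable_funM => //.
apply: measurableT_comp => //; apply: measurable_funM => //.
apply: measurable_funM => //; apply: measurable_sum => k.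
by apply: measurable_funX; exact: measurable_walk.
Qed.

Lemma discrete_survival_itv omega : 0 <= discrete_survival omega <= 1.
Proof.
rewrite expR_ge0/= -expR0 ler_expR mulNr oppr_le0 divr_ge0//.
rewrite mulr_ge0 ?sqr_ge0// mulr_ge0 ?(ltW h_gt0)//.
by apply: sumr_ge0 => k _; exact: sqr_ge0.
Qed.

Lemma measurable_walk_functional (f : pathspace R -> R) n : continuous f ->
  measurable_fun [set: Omega] (fun omega => f (interp_path h n (walk omega))).
Proof.
move=> cf; have mF := @measurable_interp_functional R h n n.+1 f cf.
have mp : measurable_fun [set: Omega] (fun w => ar_path (fun=> 1) x (dW^~ w) n).
  by apply: measurable_ar_path => i _; exact: measurable_increment.
apply: eq_measurable_fun (measurableT_comp mF mp) => w _ /=.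
by congr (f _); apply: eq_interp_path => k kn; exact: nth_ar_path.
Qed.

Lemma measurable_ou_functional (f : pathspace R -> R) n : continuous f ->
  measurable_fun [set: Omega'] (fun omega =>
    f (interp_path h n (ou_chain h e x N (eval_at (B omega))))).
Proof.
move=> cf; have mF := @measurable_interp_functional R h n n.+1 f cf.
have mp : measurable_fun [set: Omega'] (fun w => ar_path ratio x (dB^~ w) n).
  by apply: measurable_ar_path => i _; exact: measurable_increment.
apply: eq_measurable_fun (measurableT_comp mF mp) => w _ /=.
by congr (f _); apply: eq_interp_path => k kn; exact: nth_ar_path.
Qed.

End discrete_girsanov.

(** * Fixed horizon, vanishing mesh *)

Section fixed_horizon.
Context (R : realType) (gamma x : R).
Hypothesis gamma_gt0 : 0 < gamma.
Context d (Omega : measurableType d) (P : probability Omega R)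
  (W : {RV P >-> pathspace R}) (eta : {RV P >-> R}).
Hypothesis W_bm : brownian_motion x W.
Hypothesis eta_exp : exponential_RV (2 / gamma ^+ 2) eta.
Hypothesis W_eta_indep : independent_pair P W eta.
Context d' (Omega' : measurableType d') (P' : probability Omega' R)
  (b : R) (B : {RV P' >-> pathspace R}).
Hypothesis B_bm : brownian_motion b B.
Variables (f : pathspace R -> R) (K : R).
Hypotheses (cf : continuous f) (f0K : forall w, 0 <= f w <= K).

Let f0 w : 0 <= f w. Proof. by have /andP[] := f0K w. Qed.
Let fK w : `|f w| <= K.
Proof. by rewrite ger0_norm//; have /andP[] := f0K w. Qed.
Let mf : measurable_fun [set: pathspace R] f.
Proof. exact: continuous_pathspace_measurable. Qed.

(** Both integrals on the right are limits of integrals over grids, which is how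
    the conditioned law is reached. *)
Lemma Rintegral_penalized_law T :
  (\int[penalized_law W eta T]_w f w)%R =
  (\int[P]_omega (f (W omega) * survival gamma T (W omega)))%R /
  (\int[P]_omega survival gamma T (W omega))%R.
Proof.
have mEf : measurable_fun [set: pathspace R] (EFin \o f).
  exact/measurable_EFinP.
have Ef0 w : (0 <= (EFin \o f) w)%E by rewrite lee_fin.
rewrite /Rintegral.
rewrite (ge0_integral_penalized_law gamma_gt0 eta_exp W_eta_indep T mEf Ef0).
rewrite fineM//.
- by rewrite mulrC.
- have mS : measurable_fun [set: Omega]
      (fun w => f (W w) * survival gamma T (W w)).
    apply: measurable_funM; first exact: measurableT_comp.
    by apply: measurableT_comp => //; exact: measurable_survival.
  have bS w : `|f (W w) * survival gamma T (W w)| <= K.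
    rewrite normrM -[leRHS]mulr1 ler_pM//.
    by rewrite ger0_norm ?survival_le1// ltW// survival_gt0.
  exact: (integrable_fin_num measurableT (bounded_integrable P mS bS)).
Qed.

Lemma integral_survival_gt0 T :
  0 < (\int[P]_omega survival gamma T (W omega))%R.
Proof.
rewrite /Rintegral -(prob_survive gamma_gt0 eta_exp W_eta_indep).
apply: fine_gt0; rewrite (prob_survive_gt0 gamma_gt0 eta_exp W_eta_indep)/=.
by rewrite -ge0_fin_numE// fin_num_measure//; exact: measurable_sq_integral_le.
Qed.

Lemma mesh_cvg (T : R) : T / m.+1%:R @[m --> \oo] --> (0 : R).
Proof.
rewrite -[X in _ --> X](mulr0 T); apply: cvgM; first exact: cvg_cst.
exact: cvg_harmonic.
Qed.

Lemma horizon_cvg (T : R) : 0 < T ->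
  (m.+1 * m.+1)%N%:R * (T / m.+1%:R) @[m --> \oo] --> +oo.
Proof.
move=> T0; apply/cvgryPge => A; near=> m.
have -> : (m.+1 * m.+1)%N%:R * (T / m.+1%:R) = m.+1%:R * T.
  by rewrite natrM; field; rewrite addrC natr1 pnatr_eq0.
rewrite -ler_pdivrMr// (@le_trans _ _ m%:R)// ?ler_nat//.
by near: m; exact: nbhs_infty_ger.
Unshelve. all: by end_near. Qed.

Lemma brownian_start : {ae P, forall omega, eval_at (W omega) 0 = x}.
Proof. by case: W_bm. Qed.

Let meshT_gt0 (T : R) m : 0 < T -> 0 < T / m.+1%:R.
Proof. by move=> T0; rewrite divr_gt0. Qed.

Lemma walk_path_cvg (T : R) omega : 0 < T -> eval_at (W omega) 0 = x ->
  interp_path (T / m.+1%:R) (m.+1 * m.+1) (walk x (T / m.+1%:R) W omega)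
    @[m --> \oo] --> W omega.
Proof.
move=> T0 W0; apply: (@interp_path_cvg _ _ (fun m => T / m.+1%:R)
  (fun m => (m.+1 * m.+1)%N) (fun m => walk x (T / m.+1%:R) W omega)).
- by move=> m; exact: meshT_gt0.
- exact: mesh_cvg.
- exact: horizon_cvg.
- move=> S e e0; apply: nearW => m k _.
  by rewrite walkE W0 subrKC subrr normr0 ltW.
Qed.

Lemma discrete_survival_cvg (T : R) omega : 0 < T -> eval_at (W omega) 0 = x ->
  discrete_survival gamma x (T / m.+1%:R) m.+1 W omega @[m --> \oo] -->
  survival gamma T (W omega).
Proof.
move=> T0 W0; rewrite /discrete_survival /survival.
apply: (@cvg_comp _ _ _ _ expR _
  (nbhs (- (gamma ^+ 2 * sq_integral T (W omega)) / 2)));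
  last exact: continuous_expR.
apply: cvgM; last exact: cvg_cst.
apply: cvgN; apply: cvgM; first exact: cvg_cst.
have csq : continuous (fun s => eval_at (W omega) s ^+ 2).
  by move=> s; apply: continuousM; exact: continuous_eval_at.
under eq_fun do under eq_bigr do rewrite walkE W0 subrKC.
exact: left_sum_cvg csq T0.
Qed.

Let mWsurv T : measurable_fun [set: Omega] (fun w => survival gamma T (W w)).
Proof. by apply: measurableT_comp => //; exact: measurable_survival. Qed.

Let surv_norm T w : `|survival gamma T w| <= 1.
Proof. by rewrite ger0_norm ?survival_le1// ltW// survival_gt0. Qed.

Let dsurv_norm T m w : 0 < T ->
  `|discrete_survival gamma x (T / m.+1%:R) m.+1 W w| <= 1.
Proof.
move=> T0; have /andP[? ?] := @discrete_survival_itv R gamma x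
  (T / m.+1%:R) m.+1 (meshT_gt0 m T0) _ _ P W w.
by rewrite ger0_norm.
Qed.

(** Numerator and denominator of [Rintegral_penalized_law] are limits of their
    discretisations by bounded convergence; by [discrete_girsanov], the ratio of
    the latter is an expectation over the chain. *)
Lemma ou_chain_cvg_penalized T : 0 < T ->
  (\int[P']_omega f (interp_path (T / m.+1%:R) (m.+1 * m.+1)
     (ou_chain (T / m.+1%:R) (gamma * (T / m.+1%:R)) x m.+1
       (eval_at (B omega)))))%R @[m --> \oo] -->
  (\int[penalized_law W eta T]_w f w)%R.
Proof.
move=> T0; rewrite Rintegral_penalized_law.
pose h m := T / m.+1%:R.
(* the discretised numerator, and the denominator when g is 1 *)
pose A (g : pathspace R -> R) m := (\int[P]_omega
  (g (interp_path (h m) (m.+1 * m.+1) (walk x (h m) W omega)) *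
   discrete_survival gamma x (h m) m.+1 W omega))%R.
have A_cvg (g : pathspace R -> R) :
    continuous g -> (forall w, `|g w| <= K + 1) ->
    A g m @[m --> \oo] -->
    (\int[P]_omega (g (W omega) * survival gamma T (W omega)))%R.
  move=> cg gK.
  have mg : measurable_fun [set: pathspace R] g.
    exact: continuous_pathspace_measurable.
  apply: (@bounded_Rintegral_cvg _ _ _ P _ _ (K + 1)).
  - move=> m; apply: measurable_funM; first exact: measurable_walk_functional.
    exact: measurable_discrete_survival.
  - by apply: measurable_funM => //; exact: measurableT_comp.
  - by move=> m w; rewrite normrM -[leRHS]mulr1 ler_pM// dsurv_norm.
  - apply: filterS brownian_start => w W0; apply: cvgM.
      apply: (@cvg_comp _ _ _ _ g _ (nbhs (W w))); last exact: cg.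
      exact: walk_path_cvg.
    exact: discrete_survival_cvg.
have K0 : 0 <= K := le_trans (f0 point) (proj2 (andP (f0K point))).
have AC m : exists2 C : R, 0 < C & (A f m = C * (\int[P']_omega
    f (interp_path (h m) (m.+1 * m.+1)
     (ou_chain (h m) (gamma * h m) x m.+1 (eval_at (B omega)))))%R) /\
    A (cst 1) m = C.
  have [C C0 CE] := @discrete_girsanov R gamma x (h m) m.+1
    (meshT_gt0 m T0) _ _ P W W_bm _ _ P' b B B_bm (m.+1 * m.+1)
    (leq_pmulr m.+1 (ltn0Sn m)).
  exists C => //; split; first exact: CE f0K.
  rewrite /A (CE (cst 1) 1); last 2 first.
  - exact: cst_continuous.
  - by move=> w; rewrite /cst ler01 lexx.
  have := Rintegral_cst P' measurableT 1.
  rewrite [X in fine X](_ : _ = 1%E); last exact: probability_setT.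
  move=> E.
  by rewrite [X in _ * X]E !mulr1.
have -> : (fun m => (\int[P']_omega f (interp_path (T / m.+1%:R) (m.+1 * m.+1)
     (ou_chain (T / m.+1%:R) (gamma * (T / m.+1%:R)) x m.+1
       (eval_at (B omega)))))%R) = (fun m => A f m / A (cst 1) m).
  apply/funext => m; have [C C0 [-> ->]] := AC m.
  by rewrite mulrAC divff ?mul1r// gt_eqF.
apply: cvgM.
  by apply: A_cvg => // w; rewrite (le_trans (fK w))// lerDl.
have -> : (\int[P]_omega survival gamma T (W omega))%R =
    (\int[P]_omega (cst 1 (W omega) * survival gamma T (W omega)))%R.
  by apply: eq_Rintegral => w _; rewrite /= mul1r.
apply: cvgV.
  rewrite (_ : (\int[P]_omega _)%R =
      (\int[P]_omega survival gamma T (W omega))%R).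
    by rewrite gt_eqF// integral_survival_gt0.
  by apply: eq_Rintegral => w _; rewrite /= mul1r.
apply: A_cvg => [|w]; first exact: cst_continuous.
by rewrite /= normr1 lerDr.
Qed.

End fixed_horizon.

(** * Horizon tending to infinity *)

Section reduction.
Context (R : realType).

Lemma Rintegral_addr_cst (Q : probability (pathspace R) R)
    (f : pathspace R -> R) (K c : R) :
  measurable_fun [set: pathspace R] f -> (forall w, `|f w| <= K) ->
  (\int[Q]_w (f w + c))%R = (\int[Q]_w f w)%R + c.
Proof.
move=> mf fK; have intf := bounded_integrable Q mf fK.
have intc : Q.-integrable [set: pathspace R] (EFin \o cst c).
  exact: finite_measure_integrable_cst.
rewrite (RintegralD measurableT intf intc).
congr (_ + _); have -> := Rintegral_cst Q measurableT c.
rewrite [X in fine X](_ : _ = 1%E); last exact: probability_setT.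
by rewrite mulr1.
Qed.

(** A bounded function becomes nonnegative by adding a constant, which shifts
    both sides of the limit equally. *)
Lemma weak_cvg_nonneg (I : Type) (F : set_system I) (FF : Filter F)
    (mu : I -> probability (pathspace R) R) (nu : probability (pathspace R) R) :
  (forall (f : pathspace R -> R) (K : R),
    continuous f -> (forall w, 0 <= f w <= K) ->
    (\int[mu i]_w f w)%R @[i --> F] --> (\int[nu]_w f w)%R) ->
  weak_cvg F mu nu.
Proof.
move=> cvg0 f cf [M [_ Mf]].
pose K := `|M| + 1.
have fK w : `|f w| <= K.
  by apply: Mf => //; rewrite (le_lt_trans (ler_norm _))// ltrDl.
have mf : measurable_fun [set: pathspace R] f.
  exact: continuous_pathspace_measurable.
have cg : continuous (fun w => f w + K).
  move=> w; apply: (@continuousD _ _ _ f (cst K) w (cf w)).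
  exact: cst_continuous.
have gK w : 0 <= f w + K <= K + K.
  have := fK w; rewrite ler_norml => /andP[f1 f2].
  by rewrite -lerBlDr sub0r f1/= lerD2r.
have := cvg0 _ _ cg gK.
rewrite (Rintegral_addr_cst _ _ mf fK).
under eq_fun do rewrite (Rintegral_addr_cst _ _ mf fK).
move=> cvgK.
have : ((\int[mu i]_w f w)%R + K) - K @[i --> F] -->
    (\int[nu]_w f w)%R + K - K.
  by apply: cvgB => //; exact: cvg_cst.
rewrite addrK; under eq_fun do rewrite addrK.
by [].
Qed.

End reduction.

Section vanishing_mesh.
Context (R : realType) (gamma x : R).
Hypothesis gamma_gt0 : 0 < gamma.
Context d' (Omega' : measurableType d') (P' : probability Omega' R)
  (X B : {RV P' >-> pathspace R}).
Hypothesis X_eq : {ae P', forall omega, eval_at (X omega) 0 = x /\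
  forall t : R, 0 <= t ->
    eval_at (X omega) t = eval_at (X omega) 0 + eval_at (B omega) t -
      gamma * (\int[lebesgue_measure]_(s in `[0%R, t]) eval_at (X omega) s)%R}.

(** The horizons [T n] and the meshes vary together; the convergence is that of
    the paths of the scheme, for almost every path of [X] and [B]. *)
Lemma ou_chain_functional_cvg (f : pathspace R -> R) (K : R) (T : nat -> R)
    (m : nat -> nat) :
  continuous f -> (forall w, 0 <= f w <= K) ->
  (forall n, 0 < T n) -> T n @[n --> \oo] --> +oo ->
  T n / (m n).+1%:R @[n --> \oo] --> (0 : R) ->
  (\int[P']_omega f (interp_path (T n / (m n).+1%:R) ((m n).+1 * (m n).+1)
     (ou_chain (T n / (m n).+1%:R) (gamma * (T n / (m n).+1%:R)) x (m n).+1
       (eval_at (B omega)))))%R @[n --> \oo] -->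
  (\int[P']_omega f (X omega))%R.
Proof.
move=> cf f0K T0 Toy h0.
have mm n : (m n).+1%:R * (T n / (m n).+1%:R) = T n.
  by rewrite mulrCA divff ?mulr1.
apply: (@bounded_Rintegral_cvg _ _ _ P' _ _ K).
- by move=> n; exact: measurable_ou_functional.
- apply: measurableT_comp => //; exact: continuous_pathspace_measurable.
- by move=> n w; rewrite ger0_norm; have /andP[] := f0K (interp_path
    (T n / (m n).+1%:R) ((m n).+1 * (m n).+1) (ou_chain (T n / (m n).+1%:R)
    (gamma * (T n / (m n).+1%:R)) x (m n).+1 (eval_at (B w)))).
- apply: filterS X_eq => w [X0 XE].
  apply: (@cvg_comp _ _ _ _ f _ (nbhs (X w))); last exact: cf.
  rewrite -X0; apply: (@ou_scheme_cvg R (X w) (B w) gamma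
    (fun n => T n / (m n).+1%:R) (fun n => (m n).+1)
    (fun n => ((m n).+1 * (m n).+1)%N)) => //.
  + by move=> n; rewrite divr_gt0.
  + by under eq_fun do rewrite mm.
  + apply/cvgryPge => A; move/cvgryPge : Toy => /(_ A); apply: filterS => n.
    move=> /le_trans; apply; rewrite natrM -mulrA mm ler_peMl// ?ler1n//.
    exact: ltW.
Qed.

End vanishing_mesh.

Theorem theorem4 (R : realType) (x gamma : R) (gamma_gt0 : 0 < gamma)
    (d : measure_display) (Omega : measurableType d) (P : probability Omega R)
    (W : {RV P >-> pathspace R}) (eta : {RV P >-> R})
    (W_bm : brownian_motion x W)
    (eta_exp : exponential_RV (2 / gamma ^+ 2) eta)
    (W_eta_indep : independent_pair P W eta)
    (d' : measure_display) (Omega' : measurableType d')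
    (P' : probability Omega' R) (X : {RV P' >-> pathspace R})
    (X_ou : ornstein_uhlenbeck gamma x X) :
  weak_cvg (pinfty_nbhs R) (penalized_law W eta) (distribution P' X).
Proof.
have [B [B_bm X_eq]] := X_ou.
apply: weak_cvg_nonneg => f K cf f0K.
have mf : measurable_fun [set: pathspace R] f.
  exact: continuous_pathspace_measurable.
have -> : (\int[distribution P' X]_w f w)%R = (\int[P']_omega f (X omega))%R.
  rewrite /Rintegral ge0_integral_distribution//.
  - exact/measurable_EFinP.
  - by move=> w; rewrite lee_fin; have /andP[] := f0K w.
apply/cvg_pinftyP => u uy.
(* horizons that are positive at every index, and not only eventually *)
pose T n := if 0 < u n then u n else 1.
have T0 n : 0 < T n by rewrite /T; case: ifPn.
have Tu : \forall n \near \oo, T n = u n.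
  by move/cvgryPgt : uy => /(_ 0); apply: filterS => n un; rewrite /T un.
have Ty : T n @[n --> \oo] --> +oo.
  apply: cvg_trans uy; apply: near_eq_cvg.
  by apply: filterS Tu => n ->.
pose E n m := (\int[P']_omega f (interp_path (T n / m.+1%:R) (m.+1 * m.+1)
     (ou_chain (T n / m.+1%:R) (gamma * (T n / m.+1%:R)) x m.+1
       (eval_at (B omega)))))%R.
(* a mesh fine enough for the expectation over the chain to be within 1/(n+1)
   of the expectation under the conditioned law *)
have /choice[m mP] : forall n, exists m, T n / m.+1%:R <= n.+1%:R^-1 /\
    `|(\int[penalized_law W eta (T n)]_w f w)%R - E n m| <= n.+1%:R^-1.
  move=> n; have n0 : 0 < n.+1%:R^-1 :> R by rewrite invr_gt0.
  have /cvgrPdist_le/(_ _ n0) H1 := mesh_cvg (T n).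
  have /cvgrPdist_le/(_ _ n0) H2 := ou_chain_cvg_penalized gamma_gt0 W_bm
    eta_exp W_eta_indep B_bm cf f0K (T0 n).
  have [m [h1 h2]] := filter_ex (filterI H1 H2); exists m; split => //.
  by move: h1; rewrite sub0r normrN; exact: le_trans (ler_norm _).
have h0 : T n / (m n).+1%:R @[n --> \oo] --> (0 : R).
  apply/cvgrPdist_le => _/posnumP[e]; near=> n.
  rewrite sub0r normrN gtr0_norm ?divr_gt0//.
  rewrite (le_trans (proj1 (mP n)))// ltW//.
  by near: n; exact: near_infty_natSinv_lt.
have EX : E n (m n) @[n --> \oo] --> (\int[P']_omega f (X omega))%R.
  exact: ou_chain_functional_cvg.
apply/cvgrPdist_le => e e0.
have e20 : 0 < e / 2 by rewrite divr_gt0.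
near=> n.
have <- : T n = u n by near: n; exact: Tu.
rewrite (_ : _ - _ = ((\int[P']_omega f (X omega))%R - E n (m n)) -
  ((\int[penalized_law W eta (T n)]_w f w)%R - E n (m n))); last by ring.
rewrite (le_trans (ler_normB _ _))// [leRHS]splitr lerD//.
  by near: n; move/cvgrPdist_le : EX => /(_ _ e20).
rewrite (le_trans (proj2 (mP n)))// ltW//.
near: n; exact: (near_infty_natSinv_lt (PosNum e20)).
Unshelve. all: by end_near. Qed.
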